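(* Let $\Omega\subset\mathbb{R}^n$ be an open set, let $d$ be a metric induced by a norm on $\mathbb{R}^n$, and let $w\in L^1_{loc}(\Omega)$, $w>0$ a.e. in $\Omega$, be a weight with $w\in W^{l,\infty}_{loc}(\Omega)$ for some integer $l\geq 1$. Then $$\mathcal{H}(\Omega,d,w\,dx)\subset W^{l,\infty}_{loc}(\Omega).$$
   Context: A metric $d$ is norm induced if $d(x,y)=\|x-y\|$ for a norm $\|\cdot\|$ on $\mathbb{R}^n$ (not necessarily Euclidean). $B(x,r)=\{y\in\mathbb{R}^n: d(x,y)<r\}$. For a measure $d\mu=w\,dx$ on $\Omega$, a locally integrable function $u:\Omega\to\mathbb{R}$ is called strongly harmonic in $\Omega$ if for every ball $B(x,r)$ with $B(x,r)\Subset\Omega$ (closure compact and contained in $\Omega$) there holds $$u(x)=\frac{1}{\mu(B(x,r))}\int_{B(x,r)}u(y)\,d\mu(y),\qquad \mu(B(x,r))=\int_{B(x,r)}w\,dx.$$ The set of all such functions is denoted $\mathcal{H}(\Omega,d,w\,dx)$. *)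

(* Defs.v *)
(* Functions on an open subset Omega of R^n are
   represented by total functions 'rV[R]_n -> R, of which only the values on
   Omega matter. *)
From HB Require Import structures.
From mathcomp Require Import all_boot all_order all_algebra.
From mathcomp Require Import all_classical all_reals all_analysis.

Set Implicit Arguments.
Unset Strict Implicit.
Unset Printing Implicit Defensive.
Import Order.TTheory GRing.Theory Num.Theory.
Import numFieldNormedType.Exports.

Local Open Scope classical_set_scope.
Local Open Scope ring_scope.

Section borel_rV.
Variables (R : realType) (n : nat).

Let coor (i : 'I_n) (x : 'rV[R]_n) : measurableTypeR R := x ord0 i.

Let rV_set0 : g_sigma_preimage coor set0.
Proof. exact: sigma_algebra0. Qed.

Let rV_setC A : g_sigma_preimage coor A -> g_sigma_preimage coor (~` A).
Proof. exact: sigma_algebraC. Qed.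

Let rV_bigcup (F : (set 'rV[R]_n)^nat) :
  (forall i, g_sigma_preimage coor (F i)) ->
  g_sigma_preimage coor (\bigcup_i (F i)).
Proof. exact: sigma_algebra_bigcup. Qed.

(* The product of the Borel sigma-algebras of the coordinates, that is, the
   Borel sigma-algebra of R^n. *)
HB.instance Definition _ := @isMeasurable.Build
  (measure_tuple_display default_measure_display)
  'rV[R]_n (g_sigma_preimage coor) rV_set0 rV_setC rV_bigcup.

End borel_rV.

Section lebesgue_rV.
Variable R : realType.

Lemma measurable_coord n (i : 'I_n) :
  measurable_fun [set: 'rV[R]_n]
    (fun x => x ord0 i : measurableTypeR R).
Proof.
move=> _ Y mY; rewrite setTI; apply: sub_sigma_algebra => /=.
rewrite -bigcup_seq/=; exists i => /=; first by rewrite mem_index_enum.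
by exists Y => //; rewrite setTI.
Qed.

Lemma measurable_fun_rVP d (T : measurableType d) n (f : T -> 'rV[R]_n) :
  (forall i,
    measurable_fun [set: T] (fun t => f t ord0 i : measurableTypeR R)) ->
  measurable_fun [set: T] f.
Proof.
move=> mf _ A mA; rewrite setTI; move: A mA.
apply: smallest_sub.
  split => /=; first by rewrite preimage_set0.
    by move=> A mA; rewrite setTD -preimage_setC; exact: measurableC.
  by move=> F mF; rewrite preimage_bigcup; exact: bigcupT_measurable.
move=> A; rewrite -bigcup_seq => -[i _ [B mB <-]].
by have := mf i measurableT B mB; rewrite !setTI.
Qed.

Definition rV_cons n (p : measurableTypeR R * 'rV[R]_n) : 'rV[R]_n.+1 :=
  row_mx (p.1 : R)%:M p.2.

Definition rV_uncons n (x : 'rV[R]_n.+1) : measurableTypeR R * 'rV[R]_n :=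
  (x ord0 ord0, \row_i x ord0 (lift ord0 i)).

Lemma rV_cons0 n p : @rV_cons n p ord0 ord0 = p.1.
Proof.
rewrite /rV_cons (_ : (ord0 : 'I_n.+1) = lshift n (ord0 : 'I_1)); last exact: val_inj.
by apply: etrans (row_mxEl _ _ _ _) _; rewrite mxE eqxx.
Qed.

Lemma rV_consS n p i : @rV_cons n p ord0 (lift ord0 i) = p.2 ord0 i.
Proof.
rewrite /rV_cons (_ : lift ord0 i = rshift 1 i); last exact: val_inj.
exact: row_mxEr.
Qed.

Lemma rV_consK n : cancel (@rV_cons n) (@rV_uncons n).
Proof.
move=> [a x]; rewrite /rV_uncons rV_cons0; congr pair.
by apply/rowP => i; rewrite mxE rV_consS.
Qed.

Lemma measurable_rV_cons n : measurable_fun setT (@rV_cons n).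
Proof.
apply: measurable_fun_rVP => i.
have [j ->|->] := unliftP ord0 i.
  under eq_fun do rewrite rV_consS.
  exact: measurableT_comp (measurable_coord j) measurable_snd.
by under eq_fun do rewrite rV_cons0; exact: measurable_fst.
Qed.

Lemma measurable_rV_uncons n : measurable_fun setT (@rV_uncons n).
Proof.
apply/measurable_fun_pairP; split => /=; first exact: measurable_coord.
apply: measurable_fun_rVP => i /=.
by under eq_fun do rewrite /comp/= mxE; exact: measurable_coord.
Qed.

Section borel_lebesgueS.
Variables (n : nat) (mu : {sigma_finite_measure set 'rV[R]_n -> \bar R}).

Definition borel_lebesgueS : set 'rV[R]_n.+1 -> \bar R :=
  pushforward (lebesgue_measure \x mu)%E (@rV_cons n).

Let mcons (A : set 'rV[R]_n.+1) :
  measurable A -> measurable (@rV_cons n @^-1` A).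
Proof.
by move=> mA; rewrite -[X in measurable X]setTI; exact: measurable_rV_cons.
Qed.

Let borel_lebesgueS0 : borel_lebesgueS set0 = 0%E.
Proof. by rewrite /borel_lebesgueS /pushforward preimage_set0 measure0. Qed.

Let borel_lebesgueS_ge0 A : (0 <= borel_lebesgueS A)%E.
Proof. by rewrite /borel_lebesgueS /pushforward measure_ge0. Qed.

Let borel_lebesgueS_sigma_additive : semi_sigma_additive borel_lebesgueS.
Proof.
move=> F mF tF mUF; rewrite /borel_lebesgueS /pushforward preimage_bigcup.
apply: measure_semi_sigma_additive.
- by move=> k; exact: mcons.
- apply/trivIsetP => /= i j _ _ ij; rewrite -preimage_setI.
  by move/trivIsetP : tF => /(_ _ _ _ _ ij) ->//; rewrite preimage_set0.
- by rewrite -preimage_bigcup; exact: mcons.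
Qed.

HB.instance Definition _ := isMeasure.Build _ _ _ borel_lebesgueS
  borel_lebesgueS0 borel_lebesgueS_ge0 borel_lebesgueS_sigma_additive.

Let borel_lebesgueS_sigma_finite : sigma_finite setT borel_lebesgueS.
Proof.
have /sigma_finiteP[F [TF ndF Foo]] := sigma_finiteT (@lebesgue_measure R).
have /sigma_finiteP[G [TG ndG Goo]] := sigma_finiteT mu.
exists (fun k => @rV_uncons n @^-1` (F k `*` G k)).
  rewrite -preimage_bigcup (_ : \bigcup_k _ = setT) ?preimage_setT//.
  rewrite -setXTT TF TG; apply/seteqP; split => -[x y].
    by move=> [k _ []/= ? ?]; split; exists k.
  move=> [/= [i _ Fix] [j _ Gjy]]; exists (maxn i j) => //; split.
  - by move: x Fix; exact/subsetPset/ndF/leq_maxl.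
  - by move: y Gjy; exact/subsetPset/ndG/leq_maxr.
move=> k; have [mF Fk] := Foo k; have [mG Gk] := Goo k; split.
  rewrite -[X in measurable X]setTI.
  by apply: measurable_rV_uncons => //; exact: measurableX.
rewrite /borel_lebesgueS /pushforward -comp_preimage.
rewrite (_ : _ \o _ = id) ?preimage_id; last exact/funext/rV_consK.
by rewrite product_measure1E// lte_mul_pinfty// ge0_fin_numE.
Qed.

HB.instance Definition _ := Measure_isSigmaFinite.Build _ _ _ borel_lebesgueS
  borel_lebesgueS_sigma_finite.

End borel_lebesgueS.

(* The n-fold product of the Lebesgue measure of R, on the Borel sets. *)
Fixpoint borel_lebesgue n : {sigma_finite_measure set 'rV[R]_n -> \bar R} :=
  match n with
  | 0 => dirac (0 : 'rV[R]_0)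
  | m.+1 => borel_lebesgueS (borel_lebesgue m)
  end.

Lemma measurable_box n (A : 'I_n -> set (measurableTypeR R)) :
  (forall i, measurable (A i)) ->
  measurable [set x : 'rV[R]_n | forall i, A i (x ord0 i)].
Proof.
move=> mA; rewrite (_ : mkset _ = \bigcap_(i in [set: 'I_n])
    ((fun x : 'rV[R]_n => x ord0 i : measurableTypeR R) @^-1` A i)); last first.
  by apply/seteqP; split => x h i; [move=> _|]; exact: (h i).
apply: fin_bigcap_measurable => [|i _]; first exact: finite_finset.
by rewrite -[X in measurable X]setTI; exact: measurable_coord.
Qed.

Lemma borel_lebesgue_box n (A : 'I_n -> set (measurableTypeR R)) :
  (forall i, measurable (A i)) ->
  borel_lebesgue n [set x | forall i, A i (x ord0 i)] =
  (\prod_(i < n) lebesgue_measure (A i))%E.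
Proof.
elim: n A => [|n IHn] A mA.
  by rewrite big_ord0 /= diracE mem_set// => -[].
rewrite big_ord_recl -IHn//= /borel_lebesgueS /pushforward.
have mA' : measurable
    [set x : 'rV[R]_n | forall i, A (lift ord0 i) (x ord0 i)].
  by apply: (@measurable_box n (fun i => A (lift ord0 i))) => i; exact: mA.
rewrite -product_measure1E//; congr (_ _).
apply/seteqP; split => -[a x]/=.
  move=> h; split => [|i]; first by have := h ord0; rewrite rV_cons0.
  by have := h (lift ord0 i); rewrite rV_consS.
move=> [Aa Ax] i; have [j ->|->] := unliftP ord0 i; first by rewrite rV_consS.
by rewrite rV_cons0.
Qed.

End lebesgue_rV.

(* A copy of 'rV[R]_n whose sigma-algebra is that of the Lebesgue measurable
   sets, the completion of the Borel sigma-algebra. *)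
Definition lebesgueType (R : realType) (n : nat) :=
  caratheodory_type ((borel_lebesgue R n)^*)%mu.

Definition lebesgue_rV (R : realType) (n : nat) :
    set (lebesgueType R n) -> \bar R :=
  @completed_measure_extension _ _ _ (borel_lebesgue R n).

HB.instance Definition _ (R : realType) (n : nat) :=
  Measure.on (@lebesgue_rV R n).

Lemma lebesgue_rV_box (R : realType) n (A : 'I_n -> set (measurableTypeR R)) :
  (forall i, measurable (A i)) ->
  lebesgue_rV [set x : lebesgueType R n |
    forall i, A i ((x : 'rV[R]_n) ord0 i)] =
  (\prod_(i < n) lebesgue_measure (A i))%E.
Proof.
move=> mA; rewrite -borel_lebesgue_box// /lebesgue_rV.
rewrite /completed_measure_extension measurable_mu_extE//.
exact: measurable_box.
Qed.

Section norm_induced.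
Variables (R : realType) (n : nat).

Definition is_norm (N : 'rV[R]_n -> R) :=
  [/\ forall x, N x = 0 -> x = 0,
      forall (a : R) x, N (a *: x) = `|a| * N x &
      forall x y, N (x + y) <= N x + N y].

Definition norm_induced (d : 'rV[R]_n -> 'rV[R]_n -> R) :=
  exists2 N, is_norm N & forall x y, d x y = N (x - y).

Definition mball (d : 'rV[R]_n -> 'rV[R]_n -> R) (x : 'rV[R]_n) (r : R) :
  set 'rV[R]_n := [set y | d x y < r].

Definition compactly_contained (A B : set 'rV[R]_n) :=
  compact (closure A) /\ closure A `<=` B.

End norm_induced.

Section function_spaces.
Variables (R : realType) (n : nat).
Local Notation leb := (@lebesgue_rV R n).
Implicit Types (U Omega : set 'rV[R]_n) (f g u w phi : 'rV[R]_n -> R).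
Implicit Types (alpha : {ffun 'I_n -> nat}).

Definition L1loc Omega f :=
  @measurable_fun _ _ (lebesgueType R n) R Omega f /\
  forall K, compact K -> K `<=` Omega -> leb.-integrable K (EFin \o f).

(* Local integrability with respect to the measure w dx. Where w > 0 almost
   everywhere, dx and w dx have the same null sets, hence the same measurable
   functions, and the integral of |u| against w dx is that of |u w|. *)
Definition L1loc_weight Omega w u :=
  @measurable_fun _ _ (lebesgueType R n) R Omega u /\
  forall K, compact K -> K `<=` Omega ->
    leb.-integrable K (EFin \o (u \* w)).

Definition strongly_harmonic Omega (d : 'rV[R]_n -> 'rV[R]_n -> R) w :
    set ('rV[R]_n -> R) :=
  [set u | L1loc_weight Omega w u /\
    forall (x : 'rV[R]_n) (r : R), 0 < r ->
      compactly_contained (mball d x r) Omega ->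
      u x = (\int[leb]_(y in mball d x r) w y)^-1 *
            \int[leb]_(y in mball d x r) (u y * w y)].

Definition partial (i : 'I_n) f : 'rV[R]_n -> R :=
  fun x => 'D_(delta_mx ord0 i) (f : 'rV[R]_n -> R^o) x.

(* All iterated partial derivatives exist and are continuous. *)
Definition smooth phi :=
  forall (s : seq 'I_n),
    continuous (foldr partial phi s) /\
    forall (i : 'I_n) (x : 'rV[R]_n),
      derivable (foldr partial phi s : 'rV[R]_n -> R^o) x (delta_mx ord0 i).

Definition test_function U phi :=
  smooth phi /\ compactly_contained [set x | phi x != 0] U.

Definition mdeg alpha : nat := (\sum_i alpha i)%N.

Definition mpartial alpha f : 'rV[R]_n -> R :=
  foldr (fun i => iter (alpha i) (partial i)) f (enum 'I_n).

Definition weak_derivative U alpha f g :=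
  [/\ L1loc U f, L1loc U g &
    forall phi, test_function U phi ->
      \int[leb]_(x in U) (f x * mpartial alpha phi x) =
      (-1) ^+ mdeg alpha * \int[leb]_(x in U) (g x * phi x)].

(* f \_ U is f on U and 0 elsewhere. *)
Definition Linfty U : set ('rV[R]_n -> R) :=
  [set f | (f \_ U : lebesgueType R n -> R) \in Lfun leb +oo%E].

Definition sobolev_infty (l : nat) U : set ('rV[R]_n -> R) :=
  [set f | Linfty U f /\
    forall alpha, (mdeg alpha <= l)%N ->
      exists2 g, Linfty U g & weak_derivative U alpha f g].

Definition sobolev_infty_loc (l : nat) Omega : set ('rV[R]_n -> R) :=
  [set f | forall U, open U -> compactly_contained U Omega ->
    sobolev_infty l U f].

End function_spaces.

(* Main.v *)
(* Averaging the mean value property over the radii replaces the indicator of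
   the ball by the cone k(z) = max (0, r - N z), so that, near a given point,
     u(x) * \int k(y - x) w(y) dy = \int k(y - x) u(y) w(y) dy,
   where the first integral is positive. As k is Lipschitz, u is continuous.
   The cone is a difference of convex functions, so its difference quotients
   are differences of monotone functions of the increment and converge in L^1;
   hence the correlation of k with a bounded function is C^1, and that of k with
   a bounded function having bounded weak derivatives up to order m is C^(m+1).
   If u is C^m with m < l, then u w has bounded weak derivatives up to order m,
   and the identity above shows that u is C^(m+1). So u is C^l. *)
Require Import Defs.
From mathcomp Require Import all_boot all_order all_algebra.
From mathcomp Require Import all_classical all_reals all_analysis.
From mathcomp Require Import measurable_realfun ess_sup_inf.
From mathcomp Require Import ring lra.

Set Implicit Arguments.
Unset Strict Implicit.
Unset Printing Implicit Defensive.
Import Order.TTheory GRing.Theory Num.Theory.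
Import numFieldNormedType.Exports.
Local Open Scope classical_set_scope.
Local Open Scope ring_scope.

(** * Lebesgue measure on R^n: Borel sets and balls *)

(** A general norm is not smooth, so in general no more than one derivative can be put on the
    kernel; convexity supplies that one, and all others must fall on [u w]. At first [u w] is only
    known to be in [L^1]. This is enough for continuity of u, which in turn makes [u w] bounded near
    the point, once w is replaced by a bounded representative; and boundedness is what the [L^1]
    convergence of the difference quotients requires. The identity holds at every point, so that u
    itself, and not a function equal to it almost everywhere, becomes regular. To avoid shrinking
    domains, the induction asserts C^m on all of Omega, while one step works near a point, on a
    neighbourhood that does not depend on m. There [u w] is cut off by 0 outside a ball; the jump
    this may create is out of reach of kernels centred well inside. Functions not smooth enough to
    serve as test functions are mollified, and their identities are recovered in the uniform
    limit. *)

Section borel.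
Context {R : realType} {n : nat}.
Local Notation V := 'rV[R]_n.
Local Notation leb := (@lebesgue_rV R n).

Lemma norm_coord (x : V) i : `|x ord0 i| <= `|x|.
Proof.
rewrite [leRHS]/Num.norm /= mx_normrE; apply/bigmax_geP; right => /=.
by exists (ord0, i).
Qed.

Lemma norm_rV_lt (x : V) (e : R) : 0 < e ->
  (`|x| < e) <-> (forall i, `|x ord0 i| < e).
Proof.
move=> e0; split=> [xe i|xe]; first exact: le_lt_trans (norm_coord x i) xe.
rewrite [ltLHS]/Num.norm /= mx_normrE; apply/bigmax_ltP; split => // -[j i] _ /=.
by rewrite (ord1 j).
Qed.

Lemma measurable_box_ball (c : V) (e : R) :
  measurable [set x : V | forall i, `|x ord0 i - c ord0 i| < e].
Proof.
apply: (@measurable_box R n (fun i => [set t | `|t - c ord0 i| < e])) => i.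
rewrite (_ : mkset _ = `](c ord0 i - e), (c ord0 i + e)[%classic).
  exact: measurable_itv.
by apply/seteqP; split => t /=; rewrite in_itv/= ltr_distl.
Qed.

(** The norm of ['rV[R]_n] is the sup norm, whose balls are boxes. An open set is the countable
    union of the boxes of rational centre and radius [1/(m+1)] that it contains. *)
Lemma open_measurable_rV (D : set V) : open D -> measurable D.
Proof.
move=> oD.
pose B (p : 'rV[rat]_n * nat) :=
  [set x : V | forall i, `|x ord0 i - ratr (p.1 ord0 i)| < p.2.+1%:R^-1].
pose P := [set p | B p `<=` D].
rewrite (_ : D = \bigcup_(p in P) B p).
  rewrite bigcup_mkcond; apply: countable_bigcupT_measurable => // -[q m].
  case: ifP => _ //.
  by have := measurable_box_ball (\row_i ratr (q ord0 i)) m.+1%:R^-1;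
    under eq_set do under eq_forall do rewrite mxE.
apply/seteqP; split => [x Dx|x [p Pp]]; last exact: Pp.
have /nbhs_ballP[e /= e0 xe] := open_nbhs_nbhs (conj oD Dx).
(* A box of radius below [e / 2] that contains x lies in the ball of radius e about x. *)
have [m _ me] := near_infty_natSinv_lt (PosNum (divr_gt0 e0 (ltr0n _ 2))).
have {me} me : m.+1%:R^-1 < e / 2 by exact: (me m (leqnn m)).
have m0 : 0 < m.+1%:R^-1 :> R by rewrite invr_gt0.
have /choice[q xq] : forall i, exists q : rat,
    `|x ord0 i - ratr q| < m.+1%:R^-1.
  move=> i; have : x ord0 i - m.+1%:R^-1 < x ord0 i + m.+1%:R^-1.
    by rewrite ltrBlDr -addrA ltrDl addr_gt0.
  move=> /rat_in_itvoo[q]; rewrite in_itv/= => /andP[q1 q2]; exists q.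
  by rewrite distrC ltr_distl q1.
exists (\row_i q i, m); last by move=> i /=; rewrite mxE; exact: xq.
move=> y yq; apply: xe; rewrite mx_norm_ball /ball_/=.
apply/norm_rV_lt => // i; rewrite !mxE.
have := yq i; have := xq i; rewrite /= mxE !ltr_norml.
move: me; move: (m.+1%:R^-1) => s me.
move=> /andP[? ?] /andP[? ?]; apply/andP; split; lra.
Qed.

Lemma closed_measurable_rV (D : set V) : closed D -> measurable D.
Proof.
move=> cD; rewrite -(setCK D); apply: measurableC.
by apply: open_measurable_rV; rewrite openC.
Qed.

Lemma open_continuous_measurable_rV (D : set V) (f : V -> R) : open D ->
  {in D, continuous f} -> measurable_fun D f.
Proof.
move=> oD cf.
move=> mD; apply: (measurability _ (RGenOInfty.measurableE R)) => //.
move=> _ [_ [a ->] <-]; apply: open_measurable_rV.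
rewrite openE => x [Dx /= fx]; apply: filterI; first exact: open_nbhs_nbhs.
apply: (cf x (mem_set Dx)); apply: open_nbhs_nbhs; split; last by [].
exact: interval_open.
Qed.

Lemma borel_lebesgue_type (A : set V) :
  measurable A -> measurable (A : set (lebesgueType R n)).
Proof. exact: caratheodory_measurable_mu_ext. Qed.

Lemma measurable_fun_lebesgue_type d (T : measurableType d)
    (D : set V) (f : V -> T) : measurable D -> measurable_fun D f ->
  measurable_fun (D : set (lebesgueType R n)) f.
Proof. by move=> mD mf _ Y mY; apply: borel_lebesgue_type; exact: mf. Qed.

Lemma lebesgue_rV_borel (A : set V) :
  measurable A -> leb A = borel_lebesgue R n A.
Proof. by move=> mA; rewrite /lebesgue_rV /completed_measure_extension measurable_mu_extE. Qed.

Lemma ball_box (c : V) (e : R) : 0 < e ->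
  ball c e = [set x : V | forall i, `](c ord0 i - e), (c ord0 i + e)[%classic (x ord0 i)].
Proof.
move=> e0; rewrite mx_norm_ball; apply/seteqP; split => x /=.
  by move=> /norm_rV_lt h i; rewrite in_itv/= -ltr_distl distrC; have := h e0 i; rewrite !mxE.
move=> h; apply/norm_rV_lt => // i; have := h i.
by rewrite /= in_itv/= -ltr_distl distrC !mxE.
Qed.

Lemma lebesgue_rV_ball (c : V) (e : R) : 0 < e ->
  leb (ball c e) = ((2 * e) ^+ n)%:E.
Proof.
move=> e0; rewrite ball_box//
  (@lebesgue_rV_box R n (fun i => `](c ord0 i - e), (c ord0 i + e)[%classic))
  => [|i]; last exact: measurable_itv.
rewrite (eq_bigr (fun=> (2 * e)%:E)) => [|i _].
  by rewrite prodEFin prodr_const card_ord.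
rewrite lebesgue_measure_itv/= lte_fin ifT; last by lra.
by rewrite -EFinB; congr EFin; lra.
Qed.

Lemma lebesgue_ball_gt0 (c : V) (e : R) : 0 < e -> (0 < leb (ball c e))%E.
Proof. by move=> e0; rewrite lebesgue_rV_ball// lte_fin exprn_gt0// mulr_gt0. Qed.

Lemma lebesgue_ball_lty (c : V) (e : R) : (leb (ball c e) < +oo)%E.
Proof.
have [e0|e0] := ltP 0 e; first by rewrite lebesgue_rV_ball// ltry.
rewrite (_ : ball c e = set0) ?measure0//; apply/seteqP; split => // x.
by rewrite mx_norm_ball => /(le_lt_trans (normr_ge0 _)); rewrite ltNge e0.
Qed.

Lemma measurable_ball_rV (c : V) (e : R) : measurable (ball c e : set (lebesgueType R n)).
Proof. by apply: borel_lebesgue_type; apply: open_measurable_rV; exact: ball_open. Qed.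

End borel.

(** * Lebesgue measure on R^n: translation invariance *)

Section translation.
Context {R : realType}.

(** The translated measure agrees with Lebesgue measure on half-open intervals, and these determine
    it. *)
Lemma lebesgue_measure_shift (a : R) (A : set R) :
  measurable (A : set (measurableTypeR R)) ->
  lebesgue_measure (( +%R ^~ a : measurableTypeR R -> measurableTypeR R) @^-1` A) =
  lebesgue_measure A.
Proof.
move=> mA; pose sh : measurableTypeR R -> measurableTypeR R := +%R ^~ a.
have msh : measurable_fun setT sh by exact: measurable_funD.
have shift_itv (x y : R) :
    sh @^-1` `]x, y]%classic = `](x - a), (y - a)]%classic.
  apply/seteqP; split => t;
  by rewrite /sh /= !in_itv/= ltrBlDr lerBrDr.
rewrite -/sh -[LHS]/(pushforward lebesgue_measure sh A).
apply/esym/lebesgue_measure_unique => //= _ [[x y] _ <-].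
rewrite /pushforward /= shift_itv !lebesgue_measure_itv/= !lte_fin ltrD2r.
by case: ifP => // _; rewrite -!EFinB; congr EFin; lra.
Qed.

Lemma measurable_shift_rV n (a : 'rV[R]_n) :
  measurable_fun setT (fun x : 'rV[R]_n => x + a).
Proof.
apply: measurable_fun_rVP => i; under eq_fun do rewrite mxE.
apply: measurable_funD; last exact: measurable_cst.
exact: measurable_coord.
Qed.

(** A translation acts separately on the first coordinate and on the others, so by induction the
    translated product measure has the right values on rectangles; the product measure is unique. *)
Lemma borel_lebesgue_shift n (a : 'rV[R]_n) (A : set 'rV[R]_n) :
  measurable A ->
  borel_lebesgue R n ((fun x => x + a) @^-1` A) = borel_lebesgue R n A.
Proof.
elim: n => [|n IHn] in a A *.
  move=> _; rewrite [X in X @^-1` _](_ : _ = id)//.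
  by apply/funext => x; apply/rowP => -[].
move=> mA; rewrite /= /borel_lebesgueS /pushforward.
pose a' : 'rV[R]_n := \row_i a ord0 (lift ord0 i).
pose tau (p : measurableTypeR R * 'rV[R]_n) : measurableTypeR R * 'rV[R]_n :=
  (p.1 + a ord0 ord0, p.2 + a').
have mtau : measurable_fun setT tau.
  apply/measurable_fun_pairP; split.
    by apply: measurable_funD => //; exact: measurable_fst.
  exact: measurableT_comp (measurable_shift_rV a') measurable_snd.
have tauE p : rV_cons p + a = rV_cons (tau p).
  apply/rowP => i; rewrite mxE; have [j ->|->] := unliftP ord0 i.
    by rewrite !rV_consS !mxE.
  by rewrite !rV_cons0.
rewrite [in LHS](_ : _ @^-1` _ = tau @^-1` (@rV_cons R n @^-1` A)); last first.
  by apply/seteqP; split => p /=; rewrite tauE.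
rewrite -[LHS]/(pushforward (lebesgue_measure \x borel_lebesgue R n)%E tau _).
apply/esym/product_measure_unique => [B C mB mC|]; last first.
  by rewrite -[X in measurable X]setTI; exact: measurable_rV_cons.
rewrite -[LHS]/((lebesgue_measure \x borel_lebesgue R n)%E
  ((( +%R ^~ (a ord0 ord0) : measurableTypeR R -> measurableTypeR R) @^-1` B)
    `*` ((fun x => x + a') @^-1` C))).
rewrite product_measure1E ?IHn//.
- by congr (_ * _)%E; exact: lebesgue_measure_shift.
- rewrite -[X in measurable X]setTI.
  by apply: measurable_funD => //; exact: measurable_cst.
- by rewrite -[X in measurable X]setTI; exact: measurable_shift_rV.
Qed.

Context {n : nat}.
Local Notation V := 'rV[R]_n.
Local Notation leb := (@lebesgue_rV R n).

(** The completed measure and the Borel one agree on Borel sets. Translation invariance, known on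
    Borel sets, thus passes to integrals of Borel functions against the completed measure. *)
Lemma integral_lebesgue_borel (f : V -> \bar R) : measurable_fun setT f ->
  (\int[leb]_x f x = \int[borel_lebesgue R n]_x f x)%E.
Proof.
move=> mf; pose phi : lebesgueType R n -> V := id.
have mphi : measurable_fun setT phi.
  by move=> _ B mB; rewrite setTI; exact: borel_lebesgue_type.
have E (g : V -> \bar R) : measurable_fun setT g -> (forall x, (0 <= g x)%E) ->
    (\int[leb]_x g x = \int[borel_lebesgue R n]_x g x)%E.
  move=> mg g0.
  rewrite -(@eq_measure_integral _ _ _ _ _ (pushforward leb phi)).
    by rewrite ge0_integral_pushforward// => x _.
  by move=> B mB _; exact: lebesgue_rV_borel.
rewrite integralE [RHS]integralE; congr (_ - _)%E; apply: E => //.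
  exact: measurable_funepos.
exact: measurable_funeneg.
Qed.

Lemma integral_lebesgue_shift (a : V) (f : V -> \bar R) : measurable_fun setT f ->
  (\int[leb]_x f ((x : V) + a)%R = \int[leb]_x f x)%E.
Proof.
move=> mf; pose phi : V -> V := +%R ^~ a.
have mphi : measurable_fun setT phi by exact: measurable_shift_rV.
rewrite [RHS]integral_lebesgue_borel// integral_lebesgue_borel; last first.
  exact: measurableT_comp mf mphi.
have E (g : V -> \bar R) : measurable_fun setT g -> (forall x, (0 <= g x)%E) ->
    (\int[borel_lebesgue R n]_x (g \o phi) x = \int[borel_lebesgue R n]_x g x)%E.
  move=> mg g0.
  transitivity (\int[pushforward (borel_lebesgue R n) phi]_x g x)%E.
    by rewrite ge0_integral_pushforward// => x _.
  by apply: eq_measure_integral => B mB _; exact: borel_lebesgue_shift.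
transitivity (\int[borel_lebesgue R n]_x (f \o phi) x)%E; first by [].
rewrite integralE [RHS]integralE funepos_comp funeneg_comp.
congr (_ - _)%E; apply: E => //; first exact: measurable_funepos.
exact: measurable_funeneg.
Qed.

Lemma Rintegral_shift (a : V) (f : V -> R) : measurable_fun setT f ->
  \int[leb]_x f ((x : V) + a) = \int[leb]_x f x.
Proof.
move=> mf; congr fine; apply: (@integral_lebesgue_shift a (EFin \o f)).
exact/measurable_EFinP.
Qed.

End translation.

(** * Directional derivatives *)

Section directional.
Context {R : realType} {V : normedModType R}.
Implicit Types (f g : V -> R) (x v : V) (d e t s : R).

(** Clearing the denominator admits [t = 0] and gives estimates that can be added and integrated. *)
Lemma is_derive_epsP f v x d : is_derive x v (f : V -> R^o) d <->
  forall e, 0 < e -> exists2 r, 0 < r & forall t, `|t| < r ->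
    `|f (x + t *: v) - f x - t * d| <= e * `|t|.
Proof.
split.
  move=> [df <-] e e0; have /cvgrPdist_le/(_ _ e0) := df.
  move=> /nbhs_ballP[r /= r0 H]; exists r => // t tr.
  have [->|t0] := eqVneq t 0; first by rewrite scale0r addr0 !subrr mul0r subr0 !normr0 mulr0.
  have := H t; rewrite /ball/= sub0r normrN => /(_ tr t0).
  rewrite -/('D_v (f : V -> R^o) x) [t *: v + x]addrC => {}H.
  rewrite (_ : _ - _ = - (t * ('D_v (f : V -> R^o) x - t^-1 *: (f (x + t *: v) - f x : R^o)))); last first.
    by rewrite mulrBr opprB /GRing.scale/= mulrA divff// mul1r.
  by rewrite normrN normrM mulrC ler_wpM2r.
move=> H.
have C : (fun h : R => h^-1 *: ((f (h *: v + x) - f x) : R^o)) @ 0^' --> (d : R^o).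
  apply/cvgrPdist_le => e e0; have [r r0 {}H] := H _ e0.
  apply/nbhs_ballP; exists r => //= t; rewrite /ball/= sub0r normrN => tr t0.
  rewrite -(ler_pM2l (x := `|t|)) ?normr_gt0// [leRHS]mulrC.
  rewrite -normrM mulrBr /GRing.scale/= mulrA divff// mul1r distrC.
  by rewrite [t *: v + x]addrC; exact: H.
split; first by apply/cvg_ex; exists d.
exact/cvg_lim.
Qed.

Lemma is_derive_line f v x d s : is_derive (x + s *: v) v (f : V -> R^o) d ->
  is_derive s 1 ((fun s => f (x + s *: v)) : R -> R^o) d.
Proof.
move=> /is_derive_epsP H.
have {H} H e : 0 < e -> exists2 r, 0 < r & forall t, `|t| < r ->
    `|f (x + (s + t) *: v) - f (x + s *: v) - t * d| <= e * `|t|.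
  move=> /H[r r0 {}H]; exists r => // t /H.
  by rewrite scalerDl addrA.
have C : (fun h : R => h^-1 *: ((f (x + (h *: (1 : R^o) + s) *: v) - f (x + s *: v)) : R^o)) @ 0^' --> (d : R^o).
  apply/cvgrPdist_le => e e0; have [r r0 {}H] := H _ e0.
  apply/nbhs_ballP; exists r => //= t; rewrite /ball/= sub0r normrN => tr t0.
  rewrite -(ler_pM2l (x := `|t|)) ?normr_gt0// [leRHS]mulrC.
  rewrite -normrM mulrBr /GRing.scale/= mulrA divff// mul1r mulr1 distrC.
  by rewrite [t + s]addrC; exact: H.
split; first by apply/cvg_ex; exists d.
exact/cvg_lim.
Qed.

(** The derivative is asked for on a segment only, because for correlations it will be known only
    near a point. *)
Lemma MVT_line f (g : V -> R) v x t :
  (forall s, `|s| <= `|t| -> is_derive (x + s *: v) v (f : V -> R^o) (g (x + s *: v))) ->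
  exists2 s, `|s| <= `|t| & f (x + t *: v) - f x = t * g (x + s *: v).
Proof.
move=> H.
have drv s : `|s| <= `|t| ->
    is_derive s 1 ((fun s => f (x + s *: v)) : R -> R^o) (g (x + s *: v)).
  by move=> /H /is_derive_line.
have cont a b : (forall s, s \in `[a, b]%R -> `|s| <= `|t|) ->
    {within `[a, b]%classic, continuous (fun s => f (x + s *: v))}.
  move=> ab; apply: continuous_in_subspaceT => s; rewrite inE => /ab st.
  apply: differentiable_continuous; apply/derivable1_diffP.
  by have [] := drv s st.
have [t0|t0] := leP 0 t.
  have sub s : s \in `[0, t]%R -> `|s| <= `|t|.
    by rewrite in_itv/= => /andP[s0 st]; rewrite !ger0_norm.
  have [||c /sub ct E] := @MVT_segment R (fun s => f (x + s *: v)) (fun s => g (x + s *: v)) _ _ t0.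
  - by move=> s /subset_itv_oo_cc /sub /drv.
  - exact: cont.
  by exists c => //; move: E; rewrite scale0r addr0 subr0 mulrC.
have sub s : s \in `[t, 0]%R -> `|s| <= `|t|.
  by rewrite in_itv/= => /andP[s0 st]; rewrite !ler0_norm ?lerN2// ltW.
have [||c /sub ct E] := @MVT_segment R (fun s => f (x + s *: v)) (fun s => g (x + s *: v)) _ _ (ltW t0).
- by move=> s /subset_itv_oo_cc /sub /drv.
- exact: cont.
exists c => //; move: E; rewrite scale0r addr0 sub0r => E.
by rewrite -opprB E mulrN opprK mulrC.
Qed.

Lemma is_derive_uniform_modulus f (g : V -> R) v x : 
  (forall y, is_derive y v (f : V -> R^o) (g y)) ->
  forall w t, (forall s, `|s| <= `|t| -> `|g (x + s *: v) - g x| <= w) ->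
  `|f (x + t *: v) - f x - t * g x| <= w * `|t|.
Proof.
move=> H w t gw; have [s st ->] := @MVT_line f g v x t (fun s _ => H _).
by rewrite -mulrBr normrM mulrC ler_wpM2r// gw.
Qed.

Lemma is_derive_mul f g x v (df dg : R) :
  is_derive x v (f : V -> R^o) df -> is_derive x v (g : V -> R^o) dg ->
  is_derive x v ((fun y => f y * g y) : V -> R^o) (f x * dg + g x * df).
Proof. exact: (@is_deriveM R V f g x v df dg). Qed.

Lemma is_derive_add f g x v (df dg : R) :
  is_derive x v (f : V -> R^o) df -> is_derive x v (g : V -> R^o) dg ->
  is_derive x v ((fun y => f y + g y) : V -> R^o) (df + dg).
Proof. exact: (@is_deriveD R V R f g x v df dg). Qed.

Lemma is_derive_scale (a : R) f x v (df : R) :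
  is_derive x v (f : V -> R^o) df ->
  is_derive x v ((fun y => a * f y) : V -> R^o) (a * df).
Proof. exact: (@is_deriveZ R V R f a x v df). Qed.

Lemma is_derive_inv f x v (df : R) : f x != 0 ->
  is_derive x v (f : V -> R^o) df ->
  is_derive x v ((fun y => (f y)^-1) : V -> R^o) (- (f x) ^- 2 * df).
Proof.
move=> fx0 [dvf <-]; split; first exact: (@derivableV R V f x v fx0 dvf).
exact: (@deriveV R V f x v fx0 dvf).
Qed.

End directional.

(** * Continuity and compactness in R^n *)

Section rV.
Context {R : realType} {n : nat}.
Local Notation V := 'rV[R]_n.

Definition vanishes_outside (f : V -> R) (r : R) := forall x, r <= `|x| -> f x = 0.

Lemma continuous_at_add (f g : V -> R) x : {for x, continuous f} ->
  {for x, continuous g} -> {for x, continuous (fun y => f y + g y)}.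
Proof. exact: (@continuousD R R^o). Qed.

Lemma continuous_at_sub (f g : V -> R) x : {for x, continuous f} ->
  {for x, continuous g} -> {for x, continuous (fun y => f y - g y)}.
Proof. exact: (@continuousB R R^o). Qed.

Lemma continuous_at_mul (f g : V -> R) x : {for x, continuous f} ->
  {for x, continuous g} -> {for x, continuous (fun y => f y * g y)}.
Proof. exact: continuousM. Qed.

Lemma continuous_epsP (f : V -> R) (x : V) : {for x, continuous f} <->
  forall e, 0 < e -> exists2 d, 0 < d & forall y, `|x - y| < d -> `|f x - f y| <= e.
Proof.
split=> [/cvgrPdist_le H e /H /nbhs_ballP[d /= d0 {}H]|H].
  by exists d => // y xy; apply: H; rewrite mx_norm_ball.
apply/(@cvgrPdist_le R R^o _ (nbhs x) (nbhs_filter x)) => e /H[d d0 {}H].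
by apply/nbhs_ballP; exists d => //= y; rewrite mx_norm_ball; exact: H.
Qed.

Lemma compact_cball (c : V) (r : R) : compact [set x : V | `|x - c| <= r].
Proof.
apply: bounded_closed_compact.
  exists (`|c| + r); split; first exact: num_real.
  move=> M cM x /= xr; apply: le_trans (ltW cM).
  by rewrite -[x](subrK c) (le_trans (ler_normD _ _))// addrC lerD.
rewrite (_ : mkset _ = (fun x : V => `|x - c|) @^-1` [set t | t <= r])//.
apply: closed_comp; last exact: closed_le.
move=> x _; apply: (@continuous_comp _ _ _ (fun x : V => x - c) (fun x => `|x|)).
  by apply: continuousB; [exact: cvg_id|exact: cst_continuous].
exact: norm_continuous.
Qed.

(** Heine's theorem on the closed ball of radius [r + 1]. Farther out, a point at distance less than
    1 is still beyond radius r, and both values are 0. *)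
Lemma uniformly_continuous_supp (f : V -> R) (r : R) :
  continuous f -> vanishes_outside f r ->
  forall e, 0 < e -> exists2 d, 0 < d &
    forall x y, `|x - y| < d -> `|f x - f y| < e.
Proof.
move=> cf f0 e e0.
have /compact_near_coveringP := @compact_cball 0 (r + 1).
move=> /(_ R (0^'+) (fun d x => forall y, `|x - y| < d -> `|f x - f y| < e) _).
case.
  move=> x _ /=.
  have /cvgrPdist_lt/(_ (e / 2)) := cf x.
  rewrite divr_gt0// => /(_ isT) /nbhs_ballP[d /= d0 xd].
  exists (ball x (d / 2), [set t : R | 0 < t < d / 2]).
    split; first by apply: nbhsx_ballx; rewrite divr_gt0.
    apply/nbhs_ballP; exists (d / 2) => /=; first by rewrite divr_gt0.
    move=> t; rewrite /ball/= sub0r normrN => td t0.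
    by rewrite t0/= (le_lt_trans (ler_norm _) td).
  move=> [z t]/= [xz /andP[t0 td]] y zy.
  have bz : ball x d z by apply: le_ball xz; lra.
  have bY : ball x d y.
    move: xz; rewrite mx_norm_ball /ball_/= => xz.
    rewrite (_ : x - y = (x - z) + (z - y)); last by rewrite addrA subrK.
    by rewrite (le_lt_trans (ler_normD _ _))//; lra.
  rewrite (_ : f z - f y = (f x - f y) - (f x - f z)); last by ring.
  rewrite (le_lt_trans (ler_normB _ _))//.
  have := xd _ bz; have := xd _ bY; lra.
move=> d /= d0 H.
exists (Num.min (d / 2) 1); first by rewrite lt_min divr_gt0// ltr01.
move=> x y; rewrite lt_min => /andP[xyd xy1].
have [xr|xr] := leP `|x| (r + 1).
  apply: (H (d / 2)) => //=.
  - by rewrite /ball/= sub0r normrN gtr0_norm ?divr_gt0//; lra.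
  - by rewrite divr_gt0.
  - by rewrite subr0.
have xE : `|x| <= `|y| + `|x - y|.
  by rewrite -[in leLHS](subrK y x) [leRHS]addrC ler_normD.
rewrite !f0 ?subr0 ?normr0//; lra.
Qed.

Lemma bounded_supp (f : V -> R) (r : R) :
  continuous f -> vanishes_outside f r ->
  exists2 M, 0 <= M & forall x, `|f x| <= M.
Proof.
move=> cf f0.
have [r0|r0] := ltP r 0.
  by exists 0 => // x; rewrite f0 ?normr0// (le_trans (ltW r0)).
have := @EVT_max_rV R n (fun x => `|f x|) [set x | `|x - 0| <= r].
case.
- by exists 0 => /=; rewrite subr0 normr0.
- exact: compact_cball.
- apply: continuous_subspaceT => x.
  by apply: (@continuous_comp _ _ _ f (fun t => `|t|)); [exact: cf|exact: norm_continuous].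
move=> c _ H; exists `|f c| => // x.
have [xr|xr] := leP `|x| r; first by apply: H; rewrite inE/= subr0.
by rewrite f0 ?normr0// ltW.
Qed.

End rV.

(** * Correlation with a continuous kernel of bounded support *)

Section integration.
Context {R : realType} {n : nat}.
Local Notation V := 'rV[R]_n.
Local Notation leb := (@lebesgue_rV R n).
Implicit Types (c h k f g : V -> R).

Definition lmeas f := @measurable_fun _ _ (lebesgueType R n) R setT f.

Definition intg h := leb.-integrable setT (EFin \o h).

Definition L1norm h := \int[leb]_x `|h x|.

Lemma continuous_borel c : continuous c -> measurable_fun setT c.
Proof. by move=> cc; apply: open_continuous_measurable_rV; [exact: openT|move=> x _; exact: cc]. Qed.

Lemma borel_lmeas c : measurable_fun setT c -> lmeas c.
Proof. by move=> mc; apply: measurable_fun_lebesgue_type. Qed.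

Lemma continuous_lmeas c : continuous c -> lmeas c.
Proof. by move=> /continuous_borel /borel_lmeas. Qed.

Lemma intg_lmeas h : intg h -> lmeas h.
Proof. by move=> /integrableP[/measurable_EFinP]. Qed.

Lemma lmeasM f g : lmeas f -> lmeas g -> lmeas (fun x => f x * g x).
Proof. exact: measurable_funM. Qed.

Lemma lmeas_max f g : lmeas f -> lmeas g -> lmeas (fun x => Num.max (f x) (g x)).
Proof. exact: measurable_maxr. Qed.

Lemma lmeas_min f g : lmeas f -> lmeas g -> lmeas (fun x => Num.min (f x) (g x)).
Proof. exact: measurable_minr. Qed.

Lemma lmeas_cst (a : R) : lmeas (fun=> a).
Proof. exact: measurable_cst. Qed.

Lemma L1norm_ge0 h : 0 <= L1norm h.
Proof. exact: Rintegral_ge0. Qed.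

Lemma intgD f g : intg f -> intg g -> intg (fun x => f x + g x).
Proof.
move=> fi gi; rewrite /intg.
rewrite (_ : _ \o _ = (EFin \o f) \+ (EFin \o g))%E; first exact: integrableD.
by apply/funext => x /=; rewrite EFinD.
Qed.

Lemma intgB f g : intg f -> intg g -> intg (fun x => f x - g x).
Proof.
move=> fi gi; rewrite /intg.
rewrite (_ : _ \o _ = (EFin \o f) \- (EFin \o g))%E; first exact: integrableB.
by apply/funext => x /=; rewrite EFinB.
Qed.

Lemma intg_norm f : intg f -> intg (fun x => `|f x|).
Proof. exact: integrable_norm. Qed.

Lemma intgM c h (M : R) : lmeas c -> (forall x, `|c x| <= M) -> intg h ->
  intg (fun x => c x * h x).
Proof.
move=> mc cM ih; apply: (@integrableMr _ _ _ leb setT _ c (EFin \o h)) => //.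
exists M; split; first exact: num_real.
by move=> N MN x _; exact: le_trans (cM x) (ltW MN).
Qed.

Lemma intgZ (a : R) h : intg h -> intg (fun x => a * h x).
Proof.
move=> ih; apply: (@intgM (cst a) h `|a|) => //; exact: measurable_cst.
Qed.

Lemma le_Rintegral_bound c h (M : R) :
  lmeas c -> (forall x, `|c x| <= M) -> intg h ->
  `|\int[leb]_x (c x * h x)| <= M * L1norm h.
Proof.
move=> mc cM ih; have ich := intgM mc cM ih.
apply: le_trans (le_normr_Rintegral _ ich) _ => //.
rewrite /L1norm -RintegralZl//; last exact: intg_norm.
apply: le_Rintegral => //; [exact: intg_norm|exact/intgZ/intg_norm|].
by move=> x _; rewrite normrM ler_wpM2r.
Qed.

Lemma Rintegral_dist_bound c1 c2 h (M1 M2 e : R) : lmeas c1 -> lmeas c2 ->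
  (forall x, `|c1 x| <= M1) -> (forall x, `|c2 x| <= M2) -> intg h ->
  (forall x, `|c1 x - c2 x| <= e) ->
  `|\int[leb]_x (c1 x * h x) - \int[leb]_x (c2 x * h x)| <= e * L1norm h.
Proof.
move=> m1 m2 b1 b2 ih c12.
rewrite -RintegralB//; try exact: intgM b1 _; try exact: intgM b2 _.
rewrite (@eq_Rintegral _ _ _ leb setT (fun x => (c1 x - c2 x) * h x)); last first.
  by move=> x _; rewrite mulrBl.
by apply: le_Rintegral_bound => //; exact: measurable_funB.
Qed.

(* M bounds both the values of h and its support. *)
Definition bmeas h := lmeas h /\
  exists M : R, forall x, `|h x| <= M /\ (M <= `|x| -> h x = 0).

Lemma bmeasP h : bmeas h <-> [/\ lmeas h, exists M : R, forall x, `|h x| <= M &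
  exists r : R, vanishes_outside h r].
Proof.
split=> [[mh [M hM]]|[mh [M hM] [r hr]]].
  by split=> //; exists M => x; have [? ?] := hM x.
split=> //; exists (Num.max M r) => x; split.
  by rewrite (le_trans (hM x))// le_max lexx.
by rewrite ge_max => /andP[_ /hr].
Qed.

Lemma intg_ball (c : V) (r : R) : intg (\1_(ball c r)).
Proof.
have mB := measurable_ball_rV c r.
apply/integrableP; split; first by apply/measurable_EFinP; exact: measurable_indic.
rewrite (eq_integral (fun x : lebesgueType R n => (\1_(ball c r) x)%:E)); last first.
  by move=> t _; rewrite gee0_abs// lee_fin.
by rewrite integral_indic// setIT; exact: lebesgue_ball_lty.
Qed.

Lemma bmeas_intg h : bmeas h -> intg h.
Proof.
move=> [mh [M hM]].
have M0 : 0 <= M by have [+ _] := hM 0; apply: le_trans.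
rewrite (_ : h = fun x => h x * \1_(ball 0 (M + 1)) x).
  by apply: (intgM mh (fun x => (hM x).1)); exact: intg_ball.
apply/funext => x; rewrite indicE; have [|xM] := boolP (x \in _); first by rewrite mulr1.
rewrite mulr0; apply: (hM x).2; rewrite leNgt; apply: contra xM => xM.
by rewrite inE mx_norm_ball /ball_/= sub0r normrN; lra.
Qed.

Lemma bmeasD f g : bmeas f -> bmeas g -> bmeas (fun x => f x + g x).
Proof.
move=> /bmeasP[mf [M fM] [r fr]] /bmeasP[mg [N gN] [s gs]]; apply/bmeasP; split.
- exact: measurable_funD.
- by exists (M + N) => x; rewrite (le_trans (ler_normD _ _))// lerD.
- exists (Num.max r s) => x; rewrite ge_max => /andP[rx sx].
  by rewrite fr// gs// addr0.
Qed.

Definition ckern k := continuous k /\ exists r, vanishes_outside k r.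

Lemma ckern_bmeas k : ckern k -> bmeas k.
Proof.
move=> [ck [r kr]]; apply/bmeasP; split; last by exists r.
  exact: continuous_lmeas.
by have [M _ kM] := bounded_supp ck kr; exists M.
Qed.

Lemma continuous_sub_rV (x : V) k : continuous k -> continuous (fun y : V => k (y - x)).
Proof.
move=> ck y; apply: (@continuous_comp _ _ _ (fun y : V => y - x) k).
  by apply: continuousB; [exact: cvg_id|exact: cst_continuous].
exact: ck.
Qed.

(* A correlation rather than a convolution: this needs the invariance of the
   measure under translations, but not under x |-> - x. *)
Definition cor k h (x : V) := \int[leb]_y (k ((y : V) - x) * h y).

Lemma cor_intg k h x : ckern k -> intg h -> intg (fun y => k (y - x) * h y).
Proof.
move=> [ck [r kr]] ih; have [M _ kM] := bounded_supp ck kr.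
by apply: (intgM (M := M)) => //; exact/continuous_lmeas/continuous_sub_rV.
Qed.

Lemma cor_distl k1 k2 h (e : R) x : ckern k1 -> ckern k2 -> intg h ->
  (forall z, `|k1 z - k2 z| <= e) -> `|cor k1 h x - cor k2 h x| <= e * L1norm h.
Proof.
move=> [c1 [r1 v1]] [c2 [r2 v2]] ih k12.
have [M1 _ b1] := bounded_supp c1 v1; have [M2 _ b2] := bounded_supp c2 v2.
apply: (Rintegral_dist_bound (M1 := M1) (M2 := M2)) => //.
all: exact/continuous_lmeas/continuous_sub_rV.
Qed.

(** The modulus of continuity of k is inherited up to the factor [L1norm h]. Integrability of h is
    enough, so this applies to [u w] before u is known to be locally bounded. *)
Lemma cor_uniform k h (e : R) : ckern k -> intg h -> 0 < e ->
  exists2 d, 0 < d & forall x y, `|x - y| < d -> `|cor k h x - cor k h y| <= e.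
Proof.
move=> [ck [r kr]] ih e0.
have [M _ kM] := bounded_supp ck kr.
have N0 := L1norm_ge0 h.
(* The [+ 1] covers the case of norm 0; the same device recurs below. *)
have e'0 : 0 < e / (L1norm h + 1) by rewrite divr_gt0// ltr_wpDl.
have [d d0 H] := uniformly_continuous_supp ck kr e'0; exists d => // x y xy.
apply: (@le_trans _ _ (e / (L1norm h + 1) * L1norm h)); last first.
  by rewrite mulrAC ler_pdivrMr ?ltr_wpDl// ler_pM2l// lerDl.
apply: (Rintegral_dist_bound (M1 := M) (M2 := M)) => //.
1,2: exact/continuous_lmeas/continuous_sub_rV.
move=> z; apply/ltW/H; rewrite opprB addrC addrA subrK.
by rewrite distrC.
Qed.

Lemma cor_continuous k h : ckern k -> intg h -> continuous (cor k h).
Proof.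
move=> ck ih x; apply/continuous_epsP => e e0.
by have [d d0 H] := cor_uniform ck ih e0; exists d => // y /H.
Qed.

Lemma ckern_shift k x : ckern k -> ckern (fun y => k (y - x)).
Proof.
move=> [ck [r kr]]; split; first exact: continuous_sub_rV.
exists (r + `|x|) => y yr; apply: kr.
by rewrite (le_trans _ (lerB_normD _ _))// normrN lerBrDr.
Qed.

End integration.

(** * Differentiation of correlations and mollification *)

Section mollification.
Context {R : realType} {n : nat}.
Local Notation V := 'rV[R]_n.
Local Notation leb := (@lebesgue_rV R n).
Implicit Types (c h k f g eta psi : V -> R) (v : V).

Lemma uniform_derive_modulus f g v : (forall y, is_derive y v (f : V -> R^o) (g y)) ->
  ckern g -> forall e, 0 < e -> exists2 d, 0 < d & forall t, `|t| < d ->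
    forall x, `|f (x + t *: v) - f x - t * g x| <= e * `|t|.
Proof.
move=> H [cg [r gr]] e e0.
have [d d0 {}gr] := uniformly_continuous_supp cg gr e0.
exists (d / (`|v| + 1)); first by rewrite divr_gt0// ltr_wpDl.
move=> t td x; apply: is_derive_uniform_modulus => // s st.
apply/ltW/gr; rewrite [x + _]addrC addrK normrZ.
rewrite ltr_pdivlMr ?ltr_wpDl// in td.
apply: le_lt_trans td; rewrite ler_pM//.
by rewrite lerDl.
Qed.

Lemma ckernZ (a : R) k : ckern k -> ckern (fun x => a * k x).
Proof.
move=> [ck [r kr]]; split; first by move=> x; apply: continuous_at_mul; [exact: cst_continuous|exact: ck].
by exists r => x /kr ->; rewrite mulr0.
Qed.

Lemma ckernB f g : ckern f -> ckern g -> ckern (fun x => f x - g x).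
Proof.
move=> [cf [r fr]] [cg [s gs]]; split.
  by move=> x; apply: continuous_at_sub; [exact: cf|exact: cg].
exists (Num.max r s) => x; rewrite ge_max => /andP[/fr -> /gs ->].
by rewrite subrr.
Qed.

Lemma ckernD f g : ckern f -> ckern g -> ckern (fun x => f x + g x).
Proof.
move=> [cf [r fr]] [cg [s gs]]; split.
  by move=> x; apply: continuous_at_add; [exact: cf|exact: cg].
exists (Num.max r s) => x; rewrite ge_max => /andP[/fr -> /gs ->].
by rewrite addr0.
Qed.

Lemma ckernMl f g : ckern f -> continuous g -> ckern (fun x => f x * g x).
Proof.
move=> [cf [r fr]] cg; split; first by move=> x; apply: continuous_at_mul; [exact: cf|exact: cg].
by exists r => x /fr ->; rewrite mul0r.
Qed.

(** Moving x by [t v] translates the kernel, so the uniform first-order expansion of k in the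
    direction [- v] is integrated against h; hence the sign. *)
Lemma cor_is_derive k dk v h x : ckern k -> ckern dk ->
  (forall z, is_derive z v (k : V -> R^o) (dk z)) -> intg h ->
  is_derive x v (cor k h : V -> R^o) (- cor dk h x).
Proof.
move=> ck cdk kdk ih; apply/is_derive_epsP => e e0.
have N0 := L1norm_ge0 h.
have e'0 : 0 < e / (L1norm h + 1) by rewrite divr_gt0// ltr_wpDl.
have dkN z : is_derive z (- v) (k : V -> R^o) (- dk z).
  apply/is_derive_epsP => e1 /((is_derive_epsP _ _ _ _).1 (kdk z))[r r0 H].
  by exists r => // t tr; have := H (- t); rewrite normrN scalerN -scaleNr mulrN mulNr; apply.
have cdkN : ckern (fun z => - dk z).
  by rewrite (_ : (fun z => _) = (fun z => -1 * dk z)); [exact: ckernZ|apply/funext => z; rewrite mulN1r].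
have [d d0 H] := uniform_derive_modulus dkN cdkN e'0.
exists d => // t /H {}H.
have ckt : ckern (fun z => k (z - t *: v)) by exact: ckern_shift.
rewrite (_ : cor k h (x + t *: v) = cor (fun z => k (z - t *: v)) h x); last first.
  by apply: eq_Rintegral => y _; rewrite opprD addrA.
rewrite (_ : _ - _ = cor (fun z => k (z - t *: v) - k z) h x - cor (fun z => - t * dk z) h x).
  apply: (@le_trans _ _ (e / (L1norm h + 1) * `|t| * L1norm h)); last first.
    by rewrite mulrAC ler_wpM2r// mulrAC ler_pdivrMr ?ltr_wpDl// ler_pM2l// lerDl.
  apply: cor_distl => // [||z]; [exact: ckernB|exact: ckernZ|].
  by have := H z; rewrite scalerN mulrN mulNr.
have i1 := cor_intg x ckt ih; have i2 := cor_intg x ck ih; have i3 := cor_intg x cdk ih.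
rewrite /cor; congr (_ - _).
  by rewrite -RintegralB//; apply: eq_Rintegral => y _; rewrite mulrBl.
rewrite mulrN -mulNr -RintegralZl//; apply: eq_Rintegral => y _.
by rewrite mulrA.
Qed.

(* The integral of (f (x + t v) - f x) / t vanishes by translation invariance,
   and the quotient converges uniformly as t tends to 0. *)
Lemma Rintegral_derive_eq0 f df v : ckern f -> ckern df ->
  (forall z, is_derive z v (f : V -> R^o) (df z)) -> \int[leb]_x df x = 0.
Proof.
move=> cf cdf fdf.
have [_ [r1 fr1]] := cf; have [_ [r2 fr2]] := cdf.
pose r := Num.max r1 r2 + `|v|.
pose C := L1norm (\1_(ball (0 : V) (r + 1))).
have C0 : 0 <= C by exact: L1norm_ge0.
apply/eqP; rewrite -normr_le0; apply/ler_addgt0Pr => e e0; rewrite add0r.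
have e'0 : 0 < e / (C + 1) by rewrite divr_gt0// ltr_wpDl.
have [d d0 H] := uniform_derive_modulus fdf cdf e'0.
(* Below d for the uniform expansion, and at most 1 so that [x + t v] is still outside the support
   of f when [r + 1 <= |x|]. *)
pose t := Num.min d 1 / 2.
have t0 : 0 < t by rewrite divr_gt0// lt_min d0 ltr01.
have td : `|t| < d.
  rewrite gtr0_norm// /t ltr_pdivrMr// (@le_lt_trans _ _ d)//.
    by rewrite ge_min lexx.
  by rewrite ltr_pMr// ltr1n.
have t1 : t <= 1.
  rewrite /t ler_pdivrMr// mul1r (@le_trans _ _ 1)//.
    by rewrite ge_min lexx orbT.
  by rewrite ler1n.
have {H} H := H t td.
have If := bmeas_intg (ckern_bmeas cf); have Id := bmeas_intg (ckern_bmeas cdf).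
have cft : ckern (fun x => f (x + t *: v)).
  by have := ckern_shift (- (t *: v)) cf; under eq_fun do rewrite opprK.
have It := bmeas_intg (ckern_bmeas cft).
pose c x := f (x + t *: v) - f x - t * df x.
have cc : ckern c by apply: ckernB; [exact: ckernB|exact: ckernZ].
have Ec : \int[leb]_x c x = - (t * \int[leb]_x df x).
  rewrite /c RintegralB//; [|exact: intgB|exact: intgZ].
  rewrite RintegralB// RintegralZl// Rintegral_shift.
    by rewrite subrr sub0r.
  by apply: continuous_borel; case: cf.
have : `|\int[leb]_x c x| <= e / (C + 1) * `|t| * C.
  rewrite (@eq_Rintegral _ _ _ leb setT (fun x => c x * \1_(ball (0 : V) (r + 1)) x)).
    apply: le_Rintegral_bound => //; last exact: intg_ball.
    by apply: continuous_lmeas; case: cc.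
  move=> x _; rewrite indicE; case: (boolP (x \in _)) => [|xr]; first by rewrite mulr1.
  rewrite mulr0 /c.
  have {}xr : r + 1 <= `|x|.
    rewrite leNgt; apply: contra xr => xr.
    by rewrite inE mx_norm_ball /ball_/= sub0r normrN.
  have m1 : r1 <= Num.max r1 r2 by rewrite le_max lexx.
  have m2 : r2 <= Num.max r1 r2 by rewrite le_max lexx orbT.
  have v0 := normr_ge0 v.
  rewrite fr1; last first.
    apply: le_trans (lerB_normD _ _); rewrite normrZ (gtr0_norm t0).
    have : t * `|v| <= `|v| by rewrite ler_piMl.
    rewrite /r in xr; lra.
  by rewrite fr1 ?fr2 ?mulr0 ?subrr//; rewrite /r in xr; lra.
rewrite Ec normrN normrM mulrAC [leRHS]mulrC ler_pM2l; last by rewrite gtr0_norm.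
move=> /le_trans; apply.
by rewrite mulrAC ler_pdivrMr ?ltr_wpDl// ler_pM2l// lerDl.
Qed.

Lemma vanishes_cor k h r s : vanishes_outside k r -> vanishes_outside h s ->
  vanishes_outside (cor k h) (r + s).
Proof.
move=> kr hs x xrs; rewrite /cor.
rewrite (@eq_Rintegral _ _ _ leb setT (fun=> 0)) => [|y _].
  by rewrite Rintegral_cst; [exact: mul0r|exact: measurableT].
have [ys|ys] := leP s `|y : V|; first by rewrite hs// mulr0.
rewrite kr ?mul0r// distrC (le_trans _ (lerB_dist _ _))//.
lra.
Qed.

Lemma cor_ckern k h : ckern k -> ckern h -> ckern (cor k h).
Proof.
move=> ck ch; split; first exact/cor_continuous/bmeas_intg/ckern_bmeas.
by have [_ [r kr]] := ck; have [_ [s hs]] := ch; exists (r + s); exact: vanishes_cor.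
Qed.

(** The difference of the two sides is the integral of the derivative of [y |-> k (y - x) * h y],
    which vanishes. *)
Lemma cor_by_parts k dk h dh v x : ckern k -> ckern dk -> ckern h -> ckern dh ->
  (forall z, is_derive z v (k : V -> R^o) (dk z)) ->
  (forall z, is_derive z v (h : V -> R^o) (dh z)) ->
  cor dk h x = - cor k dh x.
Proof.
move=> ck cdk ch cdh kdk hdh.
have I := fun h ch => bmeas_intg (@ckern_bmeas R n h ch).
apply/eqP; rewrite -addr_eq0; apply/eqP.
rewrite /cor -RintegralD//; [|exact: cor_intg (I _ ch)|exact: cor_intg (I _ cdh)].
apply: (@Rintegral_derive_eq0 (fun y => k (y - x) * h y) _ v).
- by apply: ckernMl; [exact: ckern_shift|case: ch].
- apply: ckernD.
    by apply: ckernMl; [exact: ckern_shift|case: ch].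
  by apply: ckernMl; [exact: ckern_shift|case: cdh].
move=> z.
have ks : is_derive z v ((fun y => k (y - x)) : V -> R^o) (dk (z - x)).
  apply/is_derive_epsP => e /((is_derive_epsP _ _ _ _).1 (kdk (z - x)))[d d0 H].
  by exists d => // t /H; rewrite [z - x + _]addrAC.
by apply: is_derive_eq (is_derive_mul ks (hdh z)) _; rewrite addrC mulrC.
Qed.

Definition mollifier eta e := [/\ ckern eta, forall x, 0 <= eta x,
  vanishes_outside eta e & \int[leb]_x eta x = 1].

(** [cor eta psi x] is the average of psi for the probability density [eta (y - x)], carried by the
    points y within e of x. *)
Lemma mollify_dist eta (e w : R) psi : mollifier eta e -> ckern psi ->
  (forall x y, `|x - y| < e -> `|psi x - psi y| <= w) ->
  forall x, `|cor eta psi x - psi x| <= w.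
Proof.
move=> [ce e0 ee e1] cp pw x.
have I := fun h ch => bmeas_intg (@ckern_bmeas R n h ch).
have ces : ckern (fun y => eta (y - x)) by exact: ckern_shift.
have E1 : \int[leb]_y eta ((y : V) - x) = 1.
  by rewrite Rintegral_shift//; apply: continuous_borel; case: ce.
have -> : psi x = \int[leb]_y (eta ((y : V) - x) * psi x).
  by rewrite RintegralZr ?E1 ?mul1r//; exact: I.
have -> : w = \int[leb]_y (eta ((y : V) - x) * w).
  by rewrite RintegralZr ?E1 ?mul1r//; exact: I.
have i1 := cor_intg x ce (I _ cp).
have i2 a : intg (fun y : V => eta (y - x) * a).
  by under eq_fun do rewrite mulrC; exact/intgZ/I.
rewrite -RintegralB//; last exact: i2.
apply: le_trans (le_normr_Rintegral _ _) _ => //.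
  by apply: intgB => //; exact: i2.
apply: le_Rintegral => //.
- by apply: intg_norm; apply: intgB => //; exact: i2.
- exact: i2.
move=> y _; rewrite -mulrBr normrM (ger0_norm (e0 _)).
have [yx|yx] := ltP `|y - x| e; first by rewrite ler_wpM2l// pw.
by rewrite ee// !mul0r.
Qed.

End mollification.

(** * Smooth kernels *)

Section smooth_kernels.
Context {R : realType} {n : nat}.
Local Notation V := 'rV[R]_n.
Local Notation leb := (@lebesgue_rV R n).
Local Notation e_ i := (delta_mx ord0 i : V).
Implicit Types (c h k f g eta psi : V -> R) (i : 'I_n).

Lemma partialE f i x (d : R) : is_derive x (e_ i) (f : V -> R^o) d -> partial i f x = d.
Proof. by move=> H; rewrite /partial derive_val. Qed.

Lemma partialP f i x : derivable (f : V -> R^o) x (e_ i) ->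
  is_derive x (e_ i) (f : V -> R^o) (partial i f x).
Proof. by move=> /derivableP. Qed.

Lemma derivable_is_derive f i x (d : R) :
  is_derive x (e_ i) (f : V -> R^o) d -> derivable (f : V -> R^o) x (e_ i).
Proof. by case. Qed.

Lemma near_eq_partial f g i x : (\near x, f x = g x) -> partial i f x = partial i g x.
Proof. by move=> fg; rewrite /partial; exact: (@near_eq_derive R V R^o). Qed.

Lemma partial_eq0 (D : set V) f i x : open D -> (forall y, D y -> f y = 0) -> D x ->
  partial i f x = 0.
Proof.
move=> oD f0 Dx; rewrite (@near_eq_partial _ (fun=> 0)).
  by apply: partialE; exact: (@is_derive_cst R V R^o).
by apply: filterS (open_nbhs_nbhs (conj oD Dx)) => y /f0.
Qed.

Lemma open_ball_compl (x0 : V) (r : R) : open [set x : V | r < `|x - x0|].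
Proof.
rewrite openE => x /= rx; apply/nbhs_ballP; exists (`|x - x0| - r) => /=.
  by rewrite subr_gt0.
move=> y; rewrite mx_norm_ball /ball_/= => xy.
have := ler_distD y x x0; lra.
Qed.

(** The strict inequality makes the outer region open, so all partial derivatives vanish there with
    the same r. *)
Definition csmooth f := smooth f /\ exists r, forall x, r < `|x| -> f x = 0.

Lemma foldr_partial_eq0 (D : set V) f s : open D -> (forall y, D y -> f y = 0) ->
  forall y, D y -> foldr (@partial R n) f s y = 0.
Proof.
move=> oD f0; elim: s => //= i s IHs y Dy; exact: (partial_eq0 i oD).
Qed.

Lemma smooth_foldr f s : smooth f -> smooth (foldr (@partial R n) f s).
Proof. by move=> sf t; rewrite -foldr_cat; exact: sf. Qed.

Lemma csmooth_foldr f s : csmooth f -> csmooth (foldr (@partial R n) f s).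
Proof.
move=> [sf [r fr]]; split; first exact: smooth_foldr.
exists r => x rx; apply: (@foldr_partial_eq0 [set x | r < `|x - 0|]).
- exact: open_ball_compl.
- by move=> y /=; rewrite subr0; exact: fr.
- by rewrite /= subr0.
Qed.

Lemma csmooth_ckern f : csmooth f -> ckern f.
Proof.
move=> [sf [r fr]]; split; first by case: (sf [::]).
by exists (r + 1) => x rx; apply: fr; lra.
Qed.

Lemma csmooth_is_derive f i x : csmooth f ->
  is_derive x (e_ i) (f : V -> R^o) (partial i f x).
Proof. by move=> [sf _]; apply: partialP; have [_] := sf [::]; exact. Qed.

Lemma foldr_partial_cor eta h s : csmooth eta -> intg h ->
  foldr (@partial R n) (cor eta h) s =
  (fun x => (-1) ^+ size s * cor (foldr (@partial R n) eta s) h x).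
Proof.
move=> se ih; elim: s => [|i s IHs] /=.
  by apply/funext => x; rewrite mul1r.
rewrite IHs; apply/funext => x; apply: partialE.
rewrite exprS mulN1r mulNr -mulrN; apply: is_derive_scale.
have ses := csmooth_foldr s se.
apply: cor_is_derive => //; first exact: csmooth_ckern.
  by apply: csmooth_ckern; exact: (csmooth_foldr [:: i] ses).
by move=> z; exact: csmooth_is_derive.
Qed.

Lemma smooth_cor eta h : csmooth eta -> intg h -> smooth (cor eta h).
Proof.
move=> se ih s; rewrite foldr_partial_cor//.
have ses := csmooth_foldr s se.
split=> [x|i x].
  apply: continuous_at_mul; first exact: cst_continuous.
  by apply: cor_continuous => //; exact: csmooth_ckern.
apply: derivable_is_derive; apply: is_derive_scale.
apply: cor_is_derive => //; first exact: csmooth_ckern.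
  by apply: csmooth_ckern; exact: (csmooth_foldr [:: i] ses).
by move=> z; exact: csmooth_is_derive.
Qed.

(* Required of test functions in place of Schwarz's theorem: it is immediate for
   products of functions of one coordinate, and inherited by correlations. *)
Definition pcomm f := forall s1 s2, perm_eq s1 s2 ->
  foldr (@partial R n) f s1 = foldr (@partial R n) f s2.

Lemma pcomm_cor eta h : csmooth eta -> pcomm eta -> intg h -> pcomm (cor eta h).
Proof.
move=> se pe ih s1 s2 s12; rewrite !foldr_partial_cor// (perm_size s12).
by rewrite (pe _ _ s12).
Qed.

Lemma is_derive_shift_rV f (v x y : V) (d : R) :
  is_derive (x - y) v (f : V -> R^o) d ->
  is_derive x v ((fun z => f (z - y)) : V -> R^o) d.
Proof.
move=> /is_derive_epsP H; apply/is_derive_epsP => e /H[r r0 {}H].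
by exists r => // t /H; rewrite [x - y + _]addrAC.
Qed.

Lemma foldr_partial_shift f (y : V) s : smooth f ->
  foldr (@partial R n) (fun x => f (x - y)) s =
  (fun x => foldr (@partial R n) f s (x - y)).
Proof.
move=> sf; elim: s => //= i s ->; apply/funext => x; apply: partialE.
by apply: is_derive_shift_rV; apply: partialP; exact: (sf s).2.
Qed.

Lemma smooth_shift f (y : V) : smooth f -> smooth (fun x => f (x - y)).
Proof.
move=> sf s; rewrite foldr_partial_shift//; split=> [|i x].
  by apply: continuous_sub_rV; exact: (sf s).1.
apply: derivable_is_derive; apply: is_derive_shift_rV; apply: partialP.
exact: (sf s).2.
Qed.

Lemma pcomm_shift f (y : V) : smooth f -> pcomm f -> pcomm (fun x => f (x - y)).
Proof. by move=> sf pf s1 s2 s12; rewrite !foldr_partial_shift// (pf _ _ s12). Qed.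

Lemma foldr_partial_scale (a : R) f s : smooth f ->
  foldr (@partial R n) (fun x => a * f x) s =
  (fun x => a * foldr (@partial R n) f s x).
Proof.
move=> sf; elim: s => //= i s ->; apply/funext => x; apply: partialE.
by apply: is_derive_scale; apply: partialP; exact: (sf s).2.
Qed.

Lemma smooth_scale (a : R) f : smooth f -> smooth (fun x => a * f x).
Proof.
move=> sf s; rewrite foldr_partial_scale//; split=> [x|i x].
  by apply: continuous_at_mul; [exact: cst_continuous|exact: (sf s).1].
by apply: derivable_is_derive; apply: is_derive_scale; apply: partialP; exact: (sf s).2.
Qed.

Lemma pcomm_scale (a : R) f : smooth f -> pcomm f -> pcomm (fun x => a * f x).
Proof. by move=> sf pf s1 s2 s12; rewrite !foldr_partial_scale// (pf _ _ s12). Qed.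

End smooth_kernels.

(** * Mollifiers *)

Section bump1.
Context {R : realType}.
Implicit Types (f g : R -> R).

Fixpoint der_class (m : nat) f : Prop :=
  if m is m'.+1 then
    exists2 g, (forall x : R, is_derive x 1 (f : R -> R^o) (g x)) & der_class m' g
  else True.

Lemma der_classS m f : der_class m.+1 f -> der_class m f.
Proof. by elim: m f => //= m IHm f [g fg /IHm dg]; exists g. Qed.

Lemma der_classD m f g : der_class m f -> der_class m g ->
  der_class m (fun x => f x + g x).
Proof.
elim: m f g => //= m IHm f g [f' ff' df'] [g' gg' dg'].
exists (fun x => f' x + g' x); last exact: IHm.
by move=> x; exact: is_derive_add.
Qed.

Lemma der_classZ m (a : R) f : der_class m f -> der_class m (fun x => a * f x).
Proof.
elim: m f => //= m IHm f [f' ff' df'].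
by exists (fun x => a * f' x); [move=> x; exact: is_derive_scale|exact: IHm].
Qed.

Lemma der_classM m f g : der_class m f -> der_class m g ->
  der_class m (fun x => f x * g x).
Proof.
elim: m f g => //= m IHm f g [f' ff' df'] [g' gg' dg'].
exists (fun x => f x * g' x + g x * f' x).
  by move=> x; exact: is_derive_mul.
apply: der_classD; apply: IHm => //.
  by apply: der_classS; exists f'.
by apply: der_classS; exists g'.
Qed.

Lemma is_derive_affine f (a b x d : R) : is_derive (a + b * x) 1 (f : R -> R^o) d ->
  is_derive x 1 ((fun x => f (a + b * x)) : R -> R^o) (b * d).
Proof.
move=> /is_derive_epsP H; apply/is_derive_epsP => e e0.
have e'0 : 0 < e / (`|b| + 1) by rewrite divr_gt0// ltr_wpDl.
have [r r0 {}H] := H _ e'0; exists (r / (`|b| + 1)); first by rewrite divr_gt0// ltr_wpDl.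
move=> t tr; have := H (t * b); rewrite normrM.
rewrite ltr_pdivlMr ?ltr_wpDl// in tr.
have tb : `|t| * `|b| <= `|t| * (`|b| + 1) by rewrite ler_wpM2l// lerDl.
move=> /(_ (le_lt_trans tb tr)).
rewrite /GRing.scale/= !mulr1 (_ : a + b * x + t * b = a + b * (x + t)); last by ring.
rewrite -mulrA => /le_trans; apply.
rewrite -mulrA ler_pM2l// mulrC ler_pdivrMr ?ltr_wpDl//.
Qed.

Lemma der_class_affine m f (a b : R) : der_class m f ->
  der_class m (fun x => f (a + b * x)).
Proof.
elim: m f => //= m IHm f [f' ff' df'].
exists (fun x => b * f' (a + b * x)); last exact/der_classZ/IHm.
by move=> x; exact: is_derive_affine.
Qed.

Lemma der_class_derive1 m f : der_class m.+1 f ->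
  (forall x : R, is_derive x 1 (f : R -> R^o) (@derive1 R R^o f x)) /\
  der_class m (@derive1 R R^o f).
Proof.
move=> [g fg dg]; have -> : @derive1 R R^o f = g by apply/funext => x; rewrite derive1E derive_val.
by [].
Qed.

(** The exponent m makes the family stable under differentiation up to linear combinations, so that
    smoothness of [flat 0] follows by induction. *)
Definition flat (m : nat) (t : R) : R := if 0 < t then t ^- m * expR (- t^-1) else 0.

(** For positive t, [exp (1/t)] is the power [m + 2] of [exp (1/((m+2) t))], and [exp s >= s]. The
    order 2 in t makes the derivative at 0 exist and vanish. *)
Lemma flat_le (m : nat) (t : R) : `|flat m t| <= m.+2%:R ^+ m.+2 * t ^+ 2.
Proof.
rewrite /flat; case: ifPn => t0; last first.
  by rewrite normr0; apply: mulr_ge0; [exact: exprn_ge0|exact: sqr_ge0].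
rewrite ger0_norm; last by rewrite mulr_ge0 ?expR_ge0// invr_ge0 exprn_ge0// ltW.
have k0 : 0 < m.+2%:R :> R by rewrite ltr0n.
have kt : 0 < (m.+2%:R * t)^-1 by rewrite invr_gt0 mulr_gt0.
have H : (m.+2%:R * t) ^- m.+2 <= expR (t^-1).
  rewrite (_ : t^-1 = m.+2%:R * (m.+2%:R * t)^-1); last first.
    by rewrite invfM mulrA divff ?gt_eqF// mul1r.
  rewrite expRM_natl -exprVn lerXn2r ?nnegrE ?expR_ge0 ?ltW//.
  by apply: lt_le_trans (expR_ge1Dx _); rewrite ltrDr.
rewrite expRN ler_pdivrMr ?expR_gt0//.
apply: (@le_trans _ _ (m.+2%:R ^+ m.+2 * t ^+ 2 * (m.+2%:R * t) ^- m.+2)).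
  rewrite exprMn (_ : t ^+ m.+2 = t ^+ m * t ^+ 2); last by rewrite -exprD addn2.
  have : t ^+ m != 0 by rewrite expf_neq0// gt_eqF.
  have : m.+2%:R ^+ m.+2 != 0 :> R by rewrite expf_neq0// gt_eqF.
  have : t != 0 by rewrite gt_eqF.
  move: (m.+2%:R ^+ m.+2) (t ^+ m) => K T tn0 Kn0 Tn0.
  by rewrite [leRHS](_ : _ = T^-1)//; field; rewrite tn0 Kn0 Tn0.
by rewrite ler_wpM2l// mulr_ge0// ?exprn_ge0// ltW.
Qed.

Lemma is_derive_flat (m : nat) (x : R) :
  is_derive x 1 (flat m : R -> R^o) (flat m.+2 x + - m%:R * flat m.+1 x).
Proof.
have [x0|x0|->] := ltgtP x 0.
- have E y : y < 0 -> flat m y = 0 by move=> y0; rewrite /flat ltNge ltW.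
  apply: (@near_eq_is_derive R R R^o (fun=> 0)).
    by near=> y; rewrite E//; near: y; exact: lt_nbhsl.
  rewrite /flat ltNge ltW//= mulr0 addr0; exact: (@is_derive_cst R R R^o).
- apply: (@near_eq_is_derive R R R^o (fun y => y ^- m * expR (- y^-1))).
    by near=> y; rewrite /flat ifT//; near: y; exact: lt_nbhsr.
  have xn0 : x != 0 by rewrite gt_eqF.
  have iV : is_derive x 1 (fun y : R => y^-1 : R^o) (- x ^- 2 * 1).
    exact: (@is_derive_inv R R id x 1 1 xn0).
  have iX : is_derive x 1 (fun y : R => y ^- m : R^o) (- m%:R * x ^- m.+1).
    have := @is_derive_inv R R (fun y => y ^+ m) x 1 (m%:R * x ^+ m.-1).
    rewrite expf_neq0// => /(_ isT) H.
    apply: is_derive_eq; first apply: H.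
      split; first exact: (@exprn_derivable R m x 1).
      by rewrite (@exp_derive R m x 1) /GRing.scale/= mulr1.
    case: m {H} => [|m]; first by rewrite !mul0r mulr0 oppr0 mul0r.
    have : x ^+ m != 0 by rewrite expf_neq0.
    rewrite /= !exprSr; move: (x ^+ m) (m.+1%:R : R) => T a T0.
    by field; rewrite ?T0 ?xn0.
  have iE : is_derive x 1 (fun y : R => expR (- y^-1) : R^o) (expR (- x^-1) * x ^- 2).
    have /(@is_derive_scale R R (-1)) := iV.
    rewrite (_ : (fun y : R => -1 * y^-1) = (fun y : R => - y^-1)); last first.
      by apply/funext => y; rewrite mulN1r.
    move=> iN; have := @is_derive1_comp R expR (fun y => - y^-1) x _ _ (is_derive_expR _) iN.
    by rewrite mulr1 mulN1r opprK.
  apply: (is_derive_eq (@is_derive_mul R R _ _ _ _ _ _ iX iE)).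
  rewrite /flat x0; congr (_ + _).
    by rewrite [expR _ * _]mulrC mulrA -invfM -exprD addnC.
  by rewrite mulrC -mulrA.
- rewrite /flat ltxx mulr0 addr0; apply/is_derive_epsP => e e0.
  set k : R := m.+2%:R ^+ m.+2.
  have k0 : 0 < k by rewrite exprn_gt0.
  exists (e / k); first by rewrite divr_gt0.
  move=> t tk; rewrite mulr0 subr0 add0r [_ *: _]mulr1 -!/(flat m _).
  rewrite {2}/flat ltxx subr0 (le_trans (flat_le _ _))//.
  rewrite -real_normK ?num_real// expr2 mulrA ler_wpM2r// -/k.
  by rewrite mulrC -ler_pdivlMr// ltW.
Unshelve. all: by end_near. Qed.

Lemma der_class_flat (k m : nat) : der_class k (flat m).
Proof.
elim: k m => //= k IHk m.
exists (fun x => flat m.+2 x + - m%:R * flat m.+1 x); first exact: is_derive_flat.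
by apply: der_classD => //; exact: der_classZ.
Qed.

(** The factors 1 and -1 give both arguments the form that [der_class_affine] expects. *)
Definition bump1 (e t : R) : R := flat 0 (e + 1 * t) * flat 0 (e + -1 * t).

Lemma der_class_bump1 (k : nat) e : der_class k (bump1 e).
Proof. by apply: der_classM; apply: der_class_affine; exact: der_class_flat. Qed.

Lemma bump1_ge0 e t : 0 <= bump1 e t.
Proof.
have F s : 0 <= flat 0 s by rewrite /flat; case: ifP => // s0; rewrite invr1 mul1r expR_ge0.
exact: mulr_ge0.
Qed.

Lemma bump1_gt0 e : 0 < e -> 0 < bump1 e 0.
Proof. by move=> e0; rewrite /bump1 !mulr0 addr0 /flat e0 invr1 mul1r mulr_gt0 ?expR_gt0. Qed.

Lemma bump1_eq0 e t : e <= `|t| -> bump1 e t = 0.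
Proof.
rewrite ler_normr /bump1 /flat mul1r mulN1r => /orP[] et.
  by rewrite [X in _ * X]ifF ?mulr0//; apply/negbTE; rewrite -leNgt; lra.
by rewrite [X in X * _]ifF ?mul0r//; apply/negbTE; rewrite -leNgt; lra.
Qed.

Lemma is_derive_iter_bump1 (e : R) (k : nat) (x : R) :
  is_derive x 1 (iter k (@derive1 R R^o) (bump1 e) : R -> R^o)
    (iter k.+1 (@derive1 R R^o) (bump1 e) x).
Proof.
have D m : forall j, der_class m (iter j (@derive1 R R^o) (bump1 e)).
  move=> j; elim: j m => [|j IHj] m; first exact: der_class_bump1.
  by have /der_class_derive1[] := IHj m.+1.
by have /der_class_derive1[] := D 1%N k.
Qed.

End bump1.

(** * Bumps in several variables and normalised mollifiers *)

Section mollifier_existence.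
Context {R : realType} {n : nat}.
Local Notation V := 'rV[R]_n.
Local Notation leb := (@lebesgue_rV R n).
Local Notation e_ i := (delta_mx ord0 i : V).

Let db (e : R) (k : nat) : R -> R := iter k (@derive1 R R^o) (bump1 e).

(** A family stable under partial derivatives: differentiation in the coordinate i raises [c i] by
    one. Iterated derivatives then depend only on how often each coordinate occurs, whence
    [pcomm]. *)
Let prod_db e (c : 'I_n -> nat) (x : V) : R := \prod_j db e (c j) (x ord0 j).

Let is_derive_coord (f : R -> R) (d : R) (x : V) i :
  is_derive (x ord0 i) 1 (f : R -> R^o) d ->
  is_derive x (e_ i) ((fun y : V => f (y ord0 i)) : V -> R^o) d.
Proof.
move=> /is_derive_epsP H; apply/is_derive_epsP => e /H[r r0 {}H].
exists r => // t /H; rewrite !mxE !eqxx mulr1.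
by rewrite /GRing.scale/= mulr1.
Qed.

Let is_derive_prod_db e (c : 'I_n -> nat) (x : V) i :
  is_derive x (e_ i) (prod_db e c : V -> R^o) (prod_db e (fun j => c j + (j == i))%N x).
Proof.
pose g (y : V) := \prod_(j | j != i) db e (c j) (y ord0 j).
have gE y t : g (y + t *: (e_ i)) = g y.
  by apply: eq_bigr => j ji; rewrite !mxE eqxx (negbTE ji) mulr0 addr0.
have -> : prod_db e c = (fun y => db e (c i) (y ord0 i) * g y).
  by apply/funext => y; rewrite /prod_db (bigD1 i).
have dg : is_derive x (e_ i) (g : V -> R^o) 0.
  apply/is_derive_epsP => a a0; exists 1 => // t _.
  by rewrite gE subrr mulr0 subr0 normr0 mulr_ge0// ltW.
apply: is_derive_eq.
  apply: is_derive_mul dg; apply: is_derive_coord; exact: is_derive_iter_bump1.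
rewrite mulr0 add0r /prod_db (bigD1 i)//= eqxx addn1 mulrC; congr (_ * _).
by apply: eq_bigr => j ji; rewrite (negbTE ji) addn0.
Qed.

Let foldr_prod_db e s : foldr (@partial R n) (prod_db e (fun=> 0%N)) s =
  prod_db e (fun j => count_mem j s).
Proof.
elim: s => //= i s ->; apply/funext => x; apply: partialE.
apply: is_derive_eq; first exact: is_derive_prod_db.
by apply: eq_bigr => j _; rewrite addnC eq_sym.
Qed.

Let continuous_prod_db e c : continuous (prod_db e c).
Proof.
rewrite /prod_db => x; elim: (index_enum _) => [|j s IHs].
  rewrite (_ : (fun y => _) = (fun=> 1)); last by apply/funext => y; rewrite big_nil.
  exact: cst_continuous.
rewrite (_ : (fun y => _) = (fun y : V => db e (c j) (y ord0 j) *
    \prod_(j <- s) db e (c j) (y ord0 j))); last by apply/funext => y; rewrite big_cons.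
apply: continuous_at_mul IHs.
apply: (@continuous_comp _ _ _ (fun y : V => y ord0 j) (db e (c j))).
  exact: coord_continuous.
apply: differentiable_continuous; apply/derivable1_diffP.
by have [] := @is_derive_iter_bump1 R e (c j) (x ord0 j).
Qed.

Lemma smooth_bump (n_gt0 : (0 < n)%N) (e : R) : 0 < e -> exists f : V -> R,
  [/\ smooth f, pcomm f, forall x, 0 <= f x, vanishes_outside f e & 0 < f 0].
Proof.
move=> e0; exists (prod_db e (fun=> 0%N)); split.
- move=> s; rewrite foldr_prod_db; split; first exact: continuous_prod_db.
  move=> i x; apply: derivable_is_derive; exact: is_derive_prod_db.
- move=> s1 s2 s12; rewrite !foldr_prod_db; congr (prod_db _ _).
  by apply/funext => j; rewrite (permP s12).
- by move=> x; apply: prodr_ge0 => j _; exact: bump1_ge0.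
- move=> x ex.
  have [j xj] : exists j, e <= `|x ord0 j|.
    apply: contrapT => /forallNP H.
    have : `|x| < e by apply/norm_rV_lt => // j; rewrite ltNge; apply/negP/H.
    by rewrite ltNge ex.
  by rewrite /prod_db (bigD1 j)//= bump1_eq0// mul0r.
- by apply: prodr_gt0 => j _; rewrite mxE; exact: bump1_gt0.
Qed.

Lemma Rintegral_gt0_at (f : V -> R) : ckern f -> (forall x, 0 <= f x) ->
  0 < f 0 -> 0 < \int[leb]_x f x.
Proof.
move=> cf f0 f00; have [c _] := cf.
have /continuous_epsP := c 0; move=> /(_ (f 0 / 2)); rewrite divr_gt0// => /(_ isT)[d d0 H].
apply: (@lt_le_trans _ _ (\int[leb]_x (f 0 / 2 * \1_(ball (0 : V) d) x))).
  rewrite RintegralZl//; last exact: intg_ball.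
  rewrite mulr_gt0// ?divr_gt0//.
  rewrite /Rintegral integral_indic//; last exact: measurable_ball_rV.
  rewrite setIT [X in fine X](_ : _ = ((2 * d) ^+ n)%:E) ?exprn_gt0 ?mulr_gt0//.
  exact: lebesgue_rV_ball.
apply: le_Rintegral => //; [exact/intgZ/intg_ball|exact/bmeas_intg/ckern_bmeas|].
move=> x _; rewrite indicE; have [|] := boolP (x \in _); last by rewrite mulr0.
rewrite inE mx_norm_ball /ball_/= mulr1 => /H; rewrite ler_norml.
by move=> /andP[_]; lra.
Qed.

Lemma mollifier_exists (n_gt0 : (0 < n)%N) (e : R) : 0 < e -> exists eta : V -> R,
  [/\ mollifier eta e, csmooth eta & pcomm eta].
Proof.
move=> e0; have [f [sf pf f0 fe f00]] := smooth_bump n_gt0 e0.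
have cf : ckern f by split; [case: (sf [::])|exists e].
have I0 := Rintegral_gt0_at cf f0 f00.
set a := \int[leb]_x f x in I0.
exists (fun x => a^-1 * f x); split.
- split.
  + exact: ckernZ.
  + by move=> x; rewrite mulr_ge0// invr_ge0 ltW.
  + by move=> x /fe ->; rewrite mulr0.
  + rewrite RintegralZl//; last exact/bmeas_intg/ckern_bmeas.
    by rewrite mulVf// gt_eqF.
- split; first exact: smooth_scale.
  by exists e => x /ltW/fe ->; rewrite mulr0.
- exact: pcomm_scale.
Qed.

End mollifier_existence.

(** * Correlation with a difference of convex functions gains one derivative *)

Section gain.
Context {R : realType} {n : nat}.
Local Notation V := 'rV[R]_n.
Local Notation leb := (@lebesgue_rV R n).
Implicit Types (c h k f g F : V -> R) (v w x : V).

Definition dquot f v (t : R) x := (f (x + t *: v) - f x) / t.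

Lemma continuous_dquot f v t : continuous f -> continuous (dquot f v t).
Proof.
move=> cf x; apply: continuous_at_mul; last exact: cst_continuous.
apply: continuous_at_sub (cf x).
apply: (@continuous_comp _ _ _ (fun y : V => y + t *: v) f); last exact: cf.
by apply: continuousD; [exact: cvg_id|exact: cst_continuous].
Qed.

(* Uniform convergence turns the right derivative into a two-sided one: the
   left difference quotient at x is the right one at x - t v. *)
Lemma is_derive_uniform_cauchy F v : continuous F ->
  (forall e, 0 < e -> exists2 d, 0 < d & forall s t x, 0 < s < d -> 0 < t < d ->
    `|dquot F v s x - dquot F v t x| <= e) ->
  exists2 G : V -> R, continuous G &
    forall x, is_derive x v (F : V -> R^o) (G x).
Proof.
move=> cF cau.
have cvgF x : cvg (dquot F v t x @[t --> 0^'+]).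
  apply/cauchy_cvgP; apply: cauchy_exP => e e0.
  have e20 : 0 < e / 2 by rewrite divr_gt0.
  have [d d0 H] := cau _ e20; exists (dquot F v (d / 2) x).
  have d20 : 0 < d / 2 < d by lra.
  suff : \forall t \near 0^'+, `|dquot F v (d / 2) x - dquot F v t x| < e by [].
  near=> t; apply: (@le_lt_trans _ _ (e / 2)); last by lra.
  apply: H => //; apply/andP; split; first by near: t; exact: nbhs_right_gt.
  by near: t; exact: nbhs_right_lt.
pose G x := lim (dquot F v t x @[t --> 0^'+]).
have FG e : 0 < e -> exists2 d, 0 < d & forall t x, 0 < t < d ->
    `|dquot F v t x - G x| <= e.
  move=> e0; have [d d0 H] := cau _ e0; exists d => // t x td.
  (* Letting s tend to 0 in the Cauchy estimate makes the convergence uniform in x. *)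
  have C : `|dquot F v t x - dquot F v s x| @[s --> 0^'+] --> `|dquot F v t x - G x|.
    by apply: cvg_norm; apply: cvgB; [exact: cvg_cst|exact: cvgF].
  apply: (cvgr_to_le C); near=> s; apply: H => //.
  apply/andP; split; first by near: s; exact: nbhs_right_gt.
  by near: s; exact: nbhs_right_lt.
have cG : continuous G.
  move=> x; apply/continuous_epsP => e e0.
  have e30 : 0 < e / 3 by rewrite divr_gt0.
  have [d d0 H] := FG _ e30.
  have d20 : 0 < d / 2 < d by lra.
  have /continuous_epsP/(_ _ e30)[r r0 {}H'] := @continuous_dquot F v (d / 2) cF x.
  exists r => // y /H' xy; have := H _ x d20; have := H _ y d20.
  move: xy; rewrite !ler_norml; lra.
exists G => // x; apply/is_derive_epsP => e e0.
have e20 : 0 < e / 2 by rewrite divr_gt0.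
have [d d0 H] := FG _ e20.
have /continuous_epsP/(_ _ e20)[r r0 Gx] := cG x.
exists (Num.min d (r / (`|v| + 1))).
  by rewrite lt_min d0 divr_gt0// ltr_wpDl.
move=> t; rewrite lt_min ltr_pdivlMr ?ltr_wpDl// => /andP[td tr].
have [t0|t0|->] := ltgtP t 0; last first.
- by rewrite scale0r addr0 subrr mul0r subr0 normr0 mulr0.
- have := H t x; rewrite t0 -{1}(gtr0_norm t0) td => /(_ isT).
  rewrite -(ler_pM2l t0) -{1}(gtr0_norm t0) -normrM mulrBr /dquot.
  rewrite mulrC divfK ?gt_eqF// => /le_trans; apply.
  by rewrite (gtr0_norm t0) mulrC ler_pM2r//; lra.
have nt0 : 0 < - t by lra.
have tN : `|t| = - t by rewrite ltr0_norm.
have := H (- t) (x + t *: v); rewrite nt0 -tN td => /(_ isT).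
rewrite /dquot -addrA tN scaleNr subrr addr0.
have := Gx (x + t *: v); rewrite opprD addrA subrr add0r normrN normrZ.
have : `|t| * `|v| < r by apply: le_lt_trans tr; rewrite ler_wpM2l// lerDl.
move=> -> /(_ isT); rewrite distrC => Gxt.
move=> Ht; have {Ht Gxt} : `|(F x - F (x + t *: v)) / - t - G x| <= e.
  by move: Ht Gxt; rewrite !ler_norml; lra.
rewrite -(ler_pM2l nt0) -{1}(gtr0_norm nt0) -normrM mulrBr.
rewrite [- t * (_ / _)]mulrC divfK ?gt_eqF// mulNr opprK.
by rewrite -normrN opprD opprB [_ * e]mulrC.
Unshelve. all: by end_near. Qed.

(** What is retained of a convex function that is Lipschitz along v. The quotients need not be
    integrable on the whole space, hence the balls that cut them off below. *)
Definition monotone_quotient g v (L : R) := [/\ continuous g,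
  (forall x s t, 0 < s -> s <= t -> dquot g v s x <= dquot g v t x) &
  (forall x t, 0 < t -> `|dquot g v t x| <= L)].

(* Since the quotients are monotone in t, the integral of |q_t - q_s| is the
   difference of the integrals of q_t and q_s, which are monotone in t and
   bounded below. *)
Lemma dquot_L1_cauchy g v L (r : R) : monotone_quotient g v L ->
  forall e, 0 < e -> exists2 d, 0 < d & forall s t, 0 < s -> s <= t -> t < d ->
  \int[leb]_z ((dquot g v t z - dquot g v s z) * \1_(ball (0 : V) r) z) <= e.
Proof.
move=> [cg gm gL] e e0.
pose Gam t := \int[leb]_z (dquot g v t z * \1_(ball (0 : V) r) z).
have mq t : lmeas (dquot g v t) by exact/continuous_lmeas/continuous_dquot.
have iq t : 0 < t -> intg (fun z => dquot g v t z * \1_(ball (0 : V) r) z).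
  by move=> t0; apply: (intgM (M := L)) => [||]; [exact: mq|move=> x; exact: gL|exact: intg_ball].
have Gmono s t : 0 < s -> s <= t -> Gam s <= Gam t.
  move=> s0 st; apply: le_Rintegral => //; [exact: iq|exact/iq/(lt_le_trans s0)|].
  by move=> x _; rewrite ler_wpM2r// gm.
have Glb t : 0 < t -> - (L * L1norm (\1_(ball (0 : V) r))) <= Gam t.
  move=> t0; have : `|Gam t| <= L * L1norm (\1_(ball (0 : V) r)).
    by apply: le_Rintegral_bound => // [x|]; [exact: gL|exact: intg_ball].
  by rewrite ler_norml => /andP[].
pose A := [set Gam t | t in [set t : R | 0 < t]].
have hA : has_inf A.
  split; first by exists (Gam 1), 1 => //=.
  by exists (- (L * L1norm (\1_(ball (0 : V) r)))) => _ [t /= t0 <-]; exact: Glb.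
(* For [s <= t < d], monotonicity gives [inf A <= Gam s <= Gam t <= Gam d < inf A + e]. *)
have [_ [d /= d0 <-] Gd] := inf_adherent e0 hA.
exists d => // s t s0 st td; have t0 := lt_le_trans s0 st.
rewrite (@eq_Rintegral _ _ _ leb setT (fun z => dquot g v t z * \1_(ball (0 : V) r) z
   - dquot g v s z * \1_(ball (0 : V) r) z)); last by move=> z _; rewrite mulrBl.
rewrite RintegralB//; [|exact: iq|exact: iq].
have : inf A <= Gam s by apply: ge_inf; [exact: hA.2|exists s].
have := Gmono t d t0 (ltW td); rewrite -/(Gam _) -/(Gam _); lra.
Qed.

(** A quotient of [cor k h] along v is the correlation of h with the quotient of k along [- v]. Its
    variation with the step is at most the bound of h times the [L^1] variations, on a ball, of the
    quotients of g1 and g2; a translation removes x from this estimate, so the quotients are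
    uniformly Cauchy. *)
Lemma cor_difference_of_convex g1 g2 v L1 L2 h :
  monotone_quotient g1 (- v) L1 -> monotone_quotient g2 (- v) L2 ->
  ckern (fun x => g1 x - g2 x) -> bmeas h ->
  exists2 G : V -> R, continuous G &
    forall x, is_derive x v (cor (fun x => g1 x - g2 x) h : V -> R^o) (G x).
Proof.
move=> q1 q2 ck bh; have ih := bmeas_intg bh.
pose k x := g1 x - g2 x; rewrite -/k in ck *.
apply: is_derive_uniform_cauchy; first exact: cor_continuous.
have [ck' [r kr]] := ck; have [_ [M hM]] := bh.
have M0 : 0 <= M by have [+ _] := hM 0; apply: le_trans.
move=> e e0; pose e' := e / 2 / (M + 1).
have e'0 : 0 < e' by rewrite !divr_gt0// ltr_wpDl.
(* Quotients of k with step at most 1 vanish outside this ball, although those of g1 and g2 may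
   not. *)
pose B : set V := ball (0 : V) (r + `|v| + 1).
have [d1 d10 H1] := dquot_L1_cauchy (r + `|v| + 1) q1 e'0.
have [d2 d20 H2] := dquot_L1_cauchy (r + `|v| + 1) q2 e'0.
exists (Num.min d1 (Num.min d2 1)); first by rewrite !lt_min d10 d20/=.
suff W s t x : 0 < s -> s <= t -> t < Num.min d1 (Num.min d2 1) ->
    `|dquot (cor k h) v t x - dquot (cor k h) v s x| <= e.
  move=> s t x /andP[s0 sd] /andP[t0 td].
  have [st|/ltW st] := leP s t; last exact: W.
  by rewrite distrC; exact: W.
move=> s0 st; rewrite !lt_min => /and3P[td1 td2 t1].
have t0 := lt_le_trans s0 st.
have kE u y : dquot k (- v) u y = dquot g1 (- v) u y - dquot g2 (- v) u y.
  by rewrite /dquot /k -mulrBl; congr (_ / _); ring.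
have ckd u : ckern (dquot k (- v) u).
  split; first exact: continuous_dquot.
  exists (r + `|u| * `|v|) => z zr; rewrite /dquot !kr ?subrr ?mul0r//.
    by apply: le_trans zr; rewrite lerDl mulr_ge0.
  by apply: le_trans (lerB_normD _ _); rewrite normrZ normrN lerBrDr.
have dE u : dquot (cor k h) v u x = cor (dquot k (- v) u) h x.
  rewrite /dquot mulrC -RintegralB//; last 2 first.
  - exact: cor_intg.
  - exact: cor_intg.
  rewrite -RintegralZl//; last by apply: intgB; exact: cor_intg.
  apply: eq_Rintegral => y _; rewrite -mulrBl mulrA; congr (_ * _).
  by rewrite mulrC scalerN opprD addrA.
(* Both increments are nonnegative by monotonicity, so D dominates the variation of the quotient of
   k and is integrated without absolute values. *)
pose D (z : V) := (dquot g1 (- v) t z - dquot g1 (- v) s z) * \1_B z +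
  (dquot g2 (- v) t z - dquot g2 (- v) s z) * \1_B z.
have [[c1 m1 b1] [c2 m2 b2]] := (q1, q2).
have mD : measurable_fun setT D.
  have mq g u : continuous g -> measurable_fun setT (dquot g (- v) u).
    by move=> cg; apply: continuous_borel; exact: continuous_dquot.
  have mB : measurable_fun setT (\1_B : V -> R).
    by apply: measurable_indic; apply: open_measurable_rV; exact: ball_open.
  by apply: measurable_funD; apply: measurable_funM => //; apply: measurable_funB; exact: mq.
have lq g u : continuous g -> lmeas (dquot g (- v) u).
  by move=> cg; exact/continuous_lmeas/continuous_dquot.
have iD1 : intg (fun z => (dquot g1 (- v) t z - dquot g1 (- v) s z) * \1_B z).
  apply: (intgM (M := L1 + L1)) => [|z|]; last exact: intg_ball.
    by apply: measurable_funB; exact: lq.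
  by rewrite (le_trans (ler_normB _ _))// lerD// b1.
have iD2 : intg (fun z => (dquot g2 (- v) t z - dquot g2 (- v) s z) * \1_B z).
  apply: (intgM (M := L2 + L2)) => [|z|]; last exact: intg_ball.
    by apply: measurable_funB; exact: lq.
  by rewrite (le_trans (ler_normB _ _))// lerD// b2.
have kD z : `|dquot k (- v) t z - dquot k (- v) s z| <= D z.
  rewrite /D indicE; have [|zB] := boolP (z \in B).
    rewrite !mulr1 !kE => _; have := m1 z _ _ s0 st; have := m2 z _ _ s0 st.
    by rewrite ler_norml; lra.
  rewrite !mulr0 addr0.
  have zr : r + `|v| + 1 <= `|z|.
    rewrite leNgt; apply: contra zB => zr.
    by rewrite inE /B mx_norm_ball /ball_/= sub0r normrN.
  have kz u : 0 < u -> u <= 1 -> k (z + u *: (- v)) = 0.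
    move=> u0 u1; apply: kr; apply: le_trans (lerB_normD _ _).
    rewrite normrZ normrN gtr0_norm//.
    have : u * `|v| <= `|v| by rewrite ler_piMl.
    lra.
  have kz0 : k z = 0 by apply: kr; have := normr_ge0 v; lra.
  rewrite /dquot !kz// ?kz0 ?subrr ?mul0r ?subrr ?normr0//; lra.
have iDx : intg (fun y => D (y - x)).
  apply: bmeas_intg; apply/bmeasP; split.
  - apply: borel_lmeas; exact: measurableT_comp mD (measurable_shift_rV (- x)).
  - exists (L1 + L1 + (L2 + L2)) => y; rewrite /D (le_trans (ler_normD _ _))//.
    have iB : `|\1_B (y - x) : R| <= 1 by rewrite indicE; case: (_ \in _); rewrite ?normr1 ?normr0.
    have L10 : 0 <= L1 by apply: le_trans (b1 0 t t0).
    have L20 : 0 <= L2 by apply: le_trans (b2 0 t t0).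
    rewrite !normrM lerD//.
      rewrite -[leRHS]mulr1 ler_pM// (le_trans (ler_normB _ _))// lerD// b1//.
    rewrite -[leRHS]mulr1 ler_pM// (le_trans (ler_normB _ _))// lerD// b2//.
  - exists (r + `|v| + 1 + `|x|) => y yr; rewrite /D indicE.
    rewrite (_ : _ \in _ = false) ?mulr0 ?addr0//; apply/negbTE.
    rewrite notin_setE /B mx_norm_ball /ball_/= sub0r normrN => yB.
    by have := lerB_dist y x; lra.
rewrite !dE /cor -RintegralB//; [|exact: cor_intg|exact: cor_intg].
have ikt : intg (fun y : V => dquot k (- v) t (y - x) * h y - dquot k (- v) s (y - x) * h y).
  by apply: intgB; exact: cor_intg.
apply: le_trans (le_normr_Rintegral _ ikt) _ => //.
apply: (@le_trans _ _ (\int[leb]_y (M * D ((y : V) - x)))).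
  apply: le_Rintegral => //; [exact: intg_norm|exact: intgZ|].
  move=> y _; rewrite -mulrBl normrM mulrC ler_pM//.
  by have [] := hM y.
rewrite RintegralZl// Rintegral_shift// /D RintegralD//.
apply: (@le_trans _ _ (M * (e' + e'))).
  by rewrite ler_wpM2l// lerD//; [exact: H1|exact: H2].
have : M * e' <= e / 2.
  by rewrite /e' mulrCA ler_piMr// ?divr_ge0// ?ltW// ltr_pdivrMr ?ltr_wpDl// mul1r ltrDl.
lra.
Qed.

End gain.

(** * The cone over a ball of a norm *)

Section norm_kernel.
Context {R : realType} {n : nat}.
Local Notation V := 'rV[R]_n.
Variables (N : V -> R) (normN : is_norm N).

Let NZ (a : R) x : N (a *: x) = `|a| * N x. Proof. by case: normN. Qed.
Let ND x y : N (x + y) <= N x + N y. Proof. by case: normN. Qed.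

Lemma is_norm0 : N 0 = 0.
Proof. by rewrite -(scale0r 0) NZ normr0 mul0r. Qed.

Lemma is_normN x : N (- x) = N x.
Proof. by rewrite -scaleN1r NZ normrN1 mul1r. Qed.

Lemma is_norm_ge0 x : 0 <= N x.
Proof. by have := ND x (- x); rewrite subrr is_norm0 is_normN; lra. Qed.

Lemma is_norm_dist x y : `|N x - N y| <= N (x - y).
Proof.
have := ND (x - y) y; rewrite subrK => h1.
have := ND (y - x) x; rewrite subrK -(opprB x y) is_normN => h2.
by rewrite ler_norml; lra.
Qed.

Lemma is_norm_le : exists2 C : R, 0 < C & forall x, N x <= C * `|x|.
Proof.
exists (1 + \sum_(i < n) N (delta_mx ord0 i)).
  by rewrite ltr_pwDl// sumr_ge0// => i _; exact: is_norm_ge0.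
move=> x; rewrite {1}(row_sum_delta x).
apply: (@le_trans _ _ (\sum_(i < n) `|x ord0 i| * N (delta_mx ord0 i))).
  elim/big_rec2 : _ => [|i a b _ ab]; first by rewrite is_norm0.
  by apply: le_trans (ND _ _) _; rewrite NZ lerD2l.
rewrite mulrDl mul1r mulr_suml; apply: ler_wpDl => //; apply: ler_sum => i _.
by rewrite mulrC ler_wpM2l ?is_norm_ge0// norm_coord.
Qed.

Lemma is_norm_continuous : continuous N.
Proof.
have [C C0 NC] := is_norm_le.
move=> x; apply/continuous_epsP => e e0; exists (e / C); first by rewrite divr_gt0.
move=> y; rewrite ltr_pdivlMr// mulrC => xy.
by apply: le_trans (is_norm_dist x y) _; rewrite (le_trans (NC _))// ltW.
Qed.

(** N is continuous and has a positive minimum on the compact unit sphere of the sup norm. *)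
Lemma is_norm_ge : exists2 c : R, 0 < c & forall x, c * `|x| <= N x.
Proof.
have [[s s1]|H] := pselect (exists s : V, `|s| = 1); last first.
  (* Without unit vectors the space is reduced to 0. *)
  exists 1 => // x; have [->|x0] := eqVneq x 0; first by rewrite normr0 mulr0 is_norm0.
  exfalso; apply: H; exists (`|x|^-1 *: x).
  by rewrite normrZ normfV normr_id mulVf// normr_eq0.
have [|||c cS cmin] := @EVT_min_rV R n N [set x | `|x| = 1].
- by exists s.
- have -> : [set x : V | `|x| = 1] =
      [set x | `|x - 0| <= 1] `&` [set x : V | `|x| = 1].
    by apply/seteqP; split => x /=; rewrite subr0; [move=> ->|case].
  apply: compact_closedI; first exact: compact_cball.
  rewrite (_ : mkset _ = (fun x : V => `|x|) @^-1` [set t | t = 1])//.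
  apply: closed_comp; last exact: closed_eq.
  by move=> x _; exact: norm_continuous.
- exact/continuous_subspaceT/is_norm_continuous.
have c1 : `|c| = 1 by rewrite inE in cS.
have Nc : 0 < N c.
  rewrite lt_neqAle is_norm_ge0 andbT eq_sym; apply/eqP => Nc0.
  have c0 : c = 0 by case: normN => + _ _; apply.
  by move: c1; rewrite c0 normr0 => /eqP; rewrite eq_sym oner_eq0.
exists (N c) => // x; have [->|x0] := eqVneq x 0; first by rewrite normr0 mulr0 is_norm0.
have nx : 0 < `|x| by rewrite normr_gt0.
have := cmin (`|x|^-1 *: x); rewrite inE /= normrZ normfV normr_id mulVf ?gt_eqF//.
by move=> /(_ erefl); rewrite NZ normfV normr_id ler_pdivlMl// mulrC.
Qed.

(** [x + s v] is the convex combination of [x + t v] and x with weight [s / t] on the former. *)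
Lemma convex_monotone_quotient (g : V -> R) (L : R) v : continuous g ->
  (forall x y (a : R), 0 <= a <= 1 ->
    g (a *: y + (1 - a) *: x) <= a * g y + (1 - a) * g x) ->
  (forall x t, 0 < t -> `|g (x + t *: v) - g x| <= L * t) ->
  monotone_quotient g v L.
Proof.
move=> cg gc gL; split=> // x.
- move=> s t s0 st; have t0 := lt_le_trans s0 st.
  have /(gc x (x + t *: v)) : 0 <= s / t <= 1.
    by apply/andP; split; [apply: divr_ge0; exact: ltW|rewrite ler_pdivrMr// mul1r].
  rewrite scalerDr scalerA divfK ?gt_eqF// addrAC -scalerDl addrC [s / t + _]addrC subrK scale1r [s *: _ + x]addrC => H.
  rewrite /dquot ler_pdivrMr// mulrAC -mulrA lerBlDr; apply: le_trans H _.
  by rewrite le_eqVlt; apply/orP; left; apply/eqP; ring.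
- by move=> t t0; rewrite /dquot normrM normfV (gtr0_norm t0) ler_pdivrMr// gL.
Qed.

Lemma is_norm_convex x y (a : R) : 0 <= a <= 1 ->
  N (a *: y + (1 - a) *: x) <= a * N y + (1 - a) * N x.
Proof.
move=> /andP[a0 a1]; apply: le_trans (ND _ _) _.
by rewrite !NZ !ger0_norm// subr_ge0.
Qed.

Lemma monotone_quotient_norm v : monotone_quotient N v (N v).
Proof.
apply: convex_monotone_quotient is_norm_convex _; first exact: is_norm_continuous.
move=> x t t0; apply: le_trans (is_norm_dist _ _) _.
by rewrite addrC addKr NZ gtr0_norm// mulrC.
Qed.

(** The maximum with a constant preserves convexity and does not increase the Lipschitz constant. *)
Lemma monotone_quotient_max_norm (r : R) v :
  monotone_quotient (fun x => Num.max (N x) r) v (N v).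
Proof.
have maxD (a b : R) : `|Num.max a r - Num.max b r| <= `|a - b|.
  by rewrite !maxEle ler_norml; have := ler_norm (a - b); have := ler_norm (b - a);
    rewrite distrC; do 2 case: ifPn; rewrite -?ltNge; lra.
apply: convex_monotone_quotient.
- move=> x; apply/continuous_epsP => e /((continuous_epsP _ _).1 (@is_norm_continuous x))[d d0 H].
  by exists d => // y /H; exact/le_trans/maxD.
- move=> x y a a01; have := is_norm_convex x y a01; move: a01 => /andP[a0 a1].
  have M1 b : b <= Num.max b r by rewrite le_max lexx.
  have M2 b : r <= Num.max b r by rewrite le_max lexx orbT.
  have Pa b : a * b <= a * Num.max b r by rewrite ler_wpM2l.
  have Qa b : (1 - a) * b <= (1 - a) * Num.max b r by rewrite ler_wpM2l// subr_ge0.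
  have Pr b : a * r <= a * Num.max b r by rewrite ler_wpM2l.
  have Qr b : (1 - a) * r <= (1 - a) * Num.max b r by rewrite ler_wpM2l// subr_ge0.
  rewrite ge_max => H; apply/andP; split.
    by have := Pa (N y); have := Qa (N x); lra.
  by have := Pr (N y); have := Qr (N x); lra.
- move=> x t t0; apply: le_trans (maxD _ _) _; apply: le_trans (is_norm_dist _ _) _.
  by rewrite addrC addKr NZ gtr0_norm// mulrC.
Qed.

(* max (0, r - N x), written as a difference of two convex functions. *)
Definition cone (r : R) (x : V) : R := Num.max (N x) r - N x.

Lemma cone_eq0 r x : r <= N x -> cone r x = 0.
Proof. by rewrite /cone => /max_l ->; rewrite subrr. Qed.

Lemma coneE r x : N x <= r -> cone r x = r - N x.
Proof. by rewrite /cone => /max_r ->. Qed.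

Lemma cone_ge0 r x : 0 <= cone r x.
Proof. by rewrite subr_ge0 le_max lexx. Qed.

Lemma cone_ckern r : ckern (cone r).
Proof.
split.
  move=> x; apply: continuous_at_sub; last exact: is_norm_continuous.
  by have [+ _ _] := monotone_quotient_max_norm r 0; apply.
have [c c0 cN] := is_norm_ge; exists (r / c) => x xr; apply: cone_eq0.
by apply: le_trans (cN x); rewrite mulrC -ler_pdivrMr.
Qed.

End norm_kernel.

(** * Functions of class C^k on an open set *)

Section Ck.
Context {R : realType} {n : nat}.
Local Notation V := 'rV[R]_n.
Local Notation e_ i := (delta_mx ord0 i : V).
Implicit Types (D : set V) (f g : V -> R).

(** Continuity and derivatives are those of the ambient space at the points of D, and [partial] is a
    total function, so the condition is pointwise in D. *)
Fixpoint Ck D (m : nat) f : Prop :=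
  (forall x, D x -> {for x, continuous f}) /\
  if m is m'.+1 then forall i : 'I_n,
    (forall x, D x -> derivable (f : V -> R^o) x (e_ i)) /\ Ck D m' (partial i f)
  else True.

Lemma Ck_continuous D m f : Ck D m f -> forall x, D x -> {for x, continuous f}.
Proof. by case: m => [|m] []. Qed.

Lemma Ck_sub D D' m f : D' `<=` D -> Ck D m f -> Ck D' m f.
Proof.
move=> sD; elim: m f => [|m IHm] f /= [cf Hf].
  by split => // x /sD; exact: cf.
split=> [x /sD|i]; first exact: cf.
by have [df pf] := Hf i; split; [move=> x /sD; exact: df|exact: IHm].
Qed.

Lemma CkS D m f : Ck D m.+1 f -> Ck D m f.
Proof.
elim: m f => [|m IHm] f /= [cf Hf]; first by split.
by split=> // i; have [df pf] := Hf i; split => //; exact: IHm.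
Qed.

Lemma Ck_le D m m' f : (m <= m')%N -> Ck D m' f -> Ck D m f.
Proof.
move=> /subnK <-; elim: (m' - m)%N => [|k IHk] //.
by rewrite addSn => /CkS.
Qed.

Lemma near_of_open D (P : V -> Prop) x : open D -> (forall y, D y -> P y) -> D x ->
  \near x, P x.
Proof. by move=> oD DP Dx; apply: filterS (open_nbhs_nbhs (conj oD Dx)) => y /DP. Qed.

(** This lets the induction on the order assert regularity on all of Omega while each step works
    near one point. *)
Lemma Ck_local D m f :
  (forall x, D x -> exists2 D' : set V, D' x & Ck D' m f) -> Ck D m f.
Proof.
elim: m f => [|m IHm] f H /=.
  by split=> // x /H[D' D'x [cf _]]; exact: cf.
split=> [x /H[D' D'x [cf _]]|i]; first exact: cf.
split=> [x /H[D' D'x [_ /(_ i)[df _]]]|]; first exact: df.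
by apply: IHm => x /H[D' D'x [_ /(_ i)[_ pf]]]; exists D'.
Qed.

Lemma eq_Ck D m f g : open D -> (forall x, D x -> f x = g x) -> Ck D m f -> Ck D m g.
Proof.
move=> oD; elim: m f g => [|m IHm] f g fg /= [cf Hf].
  split=> // x Dx; apply/continuous_epsP => e e0.
  have /continuous_epsP/(_ _ e0)[d d0 H] := cf _ Dx.
  have /nbhs_ballP[r /= r0 xr] := open_nbhs_nbhs (conj oD Dx).
  exists (Num.min d r); first by rewrite lt_min d0.
  move=> y; rewrite lt_min => /andP[xd xr'].
  by rewrite -!fg//; [exact: H|apply: xr; rewrite mx_norm_ball].
have eq_near x : D x -> \near x, f x = g x by exact: near_of_open.
split=> [x Dx|i].
  by have := Ck_continuous (IHm f g fg (CkS (conj cf Hf))) Dx.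
have [df pf] := Hf i; split=> [x Dx|].
  exact: (@near_eq_derivable R V R^o _ _ _ _ (eq_near _ Dx)) (df _ Dx).
by apply: IHm pf => x Dx; apply: near_eq_partial; exact: eq_near.
Qed.

Lemma Ck_of_derive D m f (g : 'I_n -> V -> R) : open D ->
  (forall x, D x -> {for x, continuous f}) ->
  (forall i x, D x -> is_derive x (e_ i) (f : V -> R^o) (g i x)) ->
  (forall i, Ck D m (g i)) -> Ck D m.+1 f.
Proof.
move=> oD cf df cg; split=> // i; split=> [x /(df i) []//|].
by apply: eq_Ck (cg i) => // x Dx; rewrite (partialE (df i x Dx)).
Qed.

Lemma Ck_partialP D m f i x : Ck D m.+1 f -> D x ->
  is_derive x (e_ i) (f : V -> R^o) (partial i f x).
Proof. by move=> [_ /(_ i)[df _]] Dx; apply: partialP; exact: df. Qed.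

Lemma Ck_partial D m f i : Ck D m.+1 f -> Ck D m (partial i f).
Proof. by move=> [_ /(_ i)[]]. Qed.

Lemma CkD D m f g : open D -> Ck D m f -> Ck D m g -> Ck D m (fun x => f x + g x).
Proof.
move=> oD; elim: m f g => [|m IHm] f g Cf Cg.
  by split=> // x Dx; apply: continuous_at_add; [exact: Cf.1|exact: Cg.1].
apply: (Ck_of_derive (g := fun i x => partial i f x + partial i g x)) => //.
- by move=> x Dx; apply: continuous_at_add; [exact: Cf.1|exact: Cg.1].
- by move=> i x Dx; apply: is_derive_add; [exact: Ck_partialP Cf _|exact: Ck_partialP Cg _].
- by move=> i; apply: IHm; exact: Ck_partial.
Qed.

Lemma CkM D m f g : open D -> Ck D m f -> Ck D m g -> Ck D m (fun x => f x * g x).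
Proof.
move=> oD; elim: m f g => [|m IHm] f g Cf Cg.
  by split=> // x Dx; apply: continuous_at_mul; [exact: Cf.1|exact: Cg.1].
apply: (Ck_of_derive (g := fun i x => f x * partial i g x + g x * partial i f x)) => //.
- by move=> x Dx; apply: continuous_at_mul; [exact: Cf.1|exact: Cg.1].
- by move=> i x Dx; apply: is_derive_mul; [exact: Ck_partialP Cf _|exact: Ck_partialP Cg _].
- by move=> i; apply: CkD => //; apply: IHm; first [exact: CkS|exact: Ck_partial].
Qed.

Lemma Ck_cst D m (a : R) : open D -> Ck D m (fun=> a).
Proof.
move=> oD; elim: m a => [|m IHm] a; first by split=> // x _; exact: cst_continuous.
apply: (Ck_of_derive (g := fun i x => 0)) => //.
by move=> x _; exact: cst_continuous.
Qed.

(** The derivative is written through [f^-1] itself, so that the induction hypothesis applies to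
    it. *)
Lemma CkV D m f : open D -> (forall x, D x -> f x != 0) -> Ck D m f ->
  Ck D m (fun x => (f x)^-1).
Proof.
move=> oD f0.
have cV m' : Ck D m' f -> forall x, D x -> {for x, continuous (fun x => (f x)^-1)}.
  by move=> Cf x Dx; apply: continuousV; [exact: f0|exact: Ck_continuous Cf _ Dx].
elim: m => [|m IHm] Cf; first by split=> //; exact: cV Cf.
apply: (Ck_of_derive (g := fun i x => (-1) * ((f x)^-1 * (f x)^-1) * partial i f x)) => //.
- exact: cV Cf.
- move=> i x Dx; apply: is_derive_eq.
    apply: is_derive_inv; [exact: f0|exact: (Ck_partialP i Cf Dx)].
  by rewrite expr2 invfM mulN1r.
- move=> i; apply: CkM => //; last exact: Ck_partial.
  apply: CkM => //; first exact: Ck_cst.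
  by apply: CkM => //; apply: IHm; exact: CkS.
Qed.

End Ck.

(** * Bounded functions with bounded weak derivatives on a ball *)

Section weak_class.
Context {R : realType} {n : nat}.
Local Notation V := 'rV[R]_n.
Local Notation leb := (@lebesgue_rV R n).
Local Notation e_ i := (delta_mx ord0 i : V).
Hypothesis n_gt0 : (0 < n)%N.
Variables (x0 : V) (r0 : R).
Implicit Types (f g h k phi psi : V -> R).

(** The supports keep a margin from the sphere of radius r0, which leaves room for mollification. *)
Definition wtest phi := [/\ smooth phi, pcomm phi &
  exists2 r : R, r < r0 & forall x, r < `|x - x0| -> phi x = 0].

Definition weak_partial (i : 'I_n) h g := forall phi, wtest phi ->
  \int[leb]_x (partial i phi x * h x) = - \int[leb]_x (phi x * g x).

(** Functions bounded everywhere and cut off by 0 outside the ball. A jump across the sphere is not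
    seen by [weak_partial], whose test functions live in smaller balls. *)
Fixpoint wclass (m : nat) h : Prop :=
  (bmeas h /\ forall x, ~ ball x0 r0 x -> h x = 0) /\
  if m is m'.+1 then forall i, exists2 g, wclass m' g & weak_partial i h g else True.

Lemma wclass_bmeas m h : wclass m h -> bmeas h.
Proof. by case: m => [|m] [[]]. Qed.

Lemma wclass_supp m h : wclass m h -> forall x, ~ ball x0 r0 x -> h x = 0.
Proof. by case: m => [|m] [[]]. Qed.

Lemma wclassS m h : wclass m.+1 h -> wclass m h.
Proof.
elim: m h => [|m IHm] h [bh Hh]; first by split.
by split=> // i; have [g /IHm Cg wg] := Hh i; exists g.
Qed.

Lemma wclass_le m m' h : (m <= m')%N -> wclass m' h -> wclass m h.
Proof.
move=> /subnK <-; elim: (m' - m)%N => [|k IHk] //.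
by rewrite addSn => /wclassS.
Qed.

Lemma vanish_center (r : R) phi : (forall x, r < `|x - x0| -> phi x = 0) ->
  vanishes_outside phi (r + `|x0| + 1).
Proof. by move=> H x xr; apply: H; have := lerB_dist x x0; lra. Qed.

Lemma wtest_csmooth phi : wtest phi -> csmooth phi.
Proof.
move=> [sp _ [r _ pr]]; split=> //; exists (r + `|x0| + 1) => x /ltW.
exact: vanish_center.
Qed.

Lemma wtest_ckern phi : wtest phi -> ckern phi.
Proof. by move=> /wtest_csmooth /csmooth_ckern. Qed.

Lemma wtest_partial_ckern phi i : wtest phi -> ckern (partial i phi).
Proof. by move=> /wtest_csmooth /(csmooth_foldr [:: i]) /csmooth_ckern. Qed.

Lemma intg_ckernM c h : ckern c -> bmeas h -> intg (fun x => c x * h x).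
Proof.
move=> cc bh; have /bmeasP[mc [M cM] _] := ckern_bmeas cc.
exact: intgM mc cM (bmeas_intg bh).
Qed.

Lemma weak_partialD i h1 g1 h2 g2 : bmeas h1 -> bmeas g1 -> bmeas h2 -> bmeas g2 ->
  weak_partial i h1 g1 -> weak_partial i h2 g2 ->
  weak_partial i (fun x => h1 x + h2 x) (fun x => g1 x + g2 x).
Proof.
move=> bh1 bg1 bh2 bg2 w1 w2 phi tp.
have cp := wtest_ckern tp; have cdp := wtest_partial_ckern i tp.
under eq_Rintegral do rewrite mulrDr.
under [in RHS]eq_Rintegral do rewrite mulrDr.
rewrite !RintegralD//; try exact: intg_ckernM.
by rewrite w1// w2// opprD.
Qed.

Lemma wclassD m h1 h2 : wclass m h1 -> wclass m h2 -> wclass m (fun x => h1 x + h2 x).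
Proof.
elim: m h1 h2 => [|m IHm] h1 h2 Ch1 Ch2.
  split=> //; split; first by apply: bmeasD; [exact: wclass_bmeas Ch1|exact: wclass_bmeas Ch2].
  by move=> x xB; rewrite (wclass_supp Ch1)// (wclass_supp Ch2)// addr0.
split; first split; first by apply: bmeasD; [exact: wclass_bmeas Ch1|exact: wclass_bmeas Ch2].
  by move=> x xB; rewrite (wclass_supp Ch1)// (wclass_supp Ch2)// addr0.
move=> i; have [_ /(_ i)[g1 Cg1 w1]] := Ch1; have [_ /(_ i)[g2 Cg2 w2]] := Ch2.
exists (fun x => g1 x + g2 x); first exact: IHm.
by apply: weak_partialD w1 w2; apply: wclass_bmeas; eassumption.
Qed.

(* Mollify psi: only its i-th partial derivative has to exist. *)
Lemma weak_partial_C1 i h g psi dpsi (r : R) : bmeas h -> bmeas g ->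
  weak_partial i h g -> continuous psi -> continuous dpsi ->
  (forall x, is_derive x (e_ i) (psi : V -> R^o) (dpsi x)) ->
  r < r0 -> (forall x, r < `|x - x0| -> psi x = 0) ->
  \int[leb]_x (dpsi x * h x) = - \int[leb]_x (psi x * g x).
Proof.
move=> bh bg whg cpsi cdpsi dpsiE rr0 psi0.
have dpsi0 x : r < `|x - x0| -> dpsi x = 0.
  move=> xr; rewrite -(partialE (dpsiE x)).
  by apply: (@partial_eq0 _ _ [set y | r < `|y - x0|]) => //; exact: open_ball_compl.
have kp : ckern psi by split=> //; exists (r + `|x0| + 1); exact: vanish_center.
have kd : ckern dpsi by split=> //; exists (r + `|x0| + 1); exact: vanish_center.
apply/eqP; rewrite -addr_eq0 -normr_le0; apply/ler_addgt0Pr => e e0; rewrite add0r.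
set L := L1norm h + L1norm g.
have L0 : 0 <= L by rewrite addr_ge0// L1norm_ge0.
have a0 : 0 < e / (L + 1) by rewrite divr_gt0// ltr_wpDl.
set a := e / (L + 1) in a0.
have [d1 d10 H1] := uniformly_continuous_supp kp.1 (vanish_center psi0) a0.
have [d2 d20 H2] := uniformly_continuous_supp kd.1 (vanish_center dpsi0) a0.
(* The first two bounds keep the uniform error of mollification below a for psi and for dpsi; the
   last makes [cor eta psi] vanish beyond the radius [r + u < r0]. *)
pose u := Num.min d1 (Num.min d2 ((r0 - r) / 2)).
have u0 : 0 < u by rewrite !lt_min d10 d20/= divr_gt0// subr_gt0.
have [eta [meta seta peta]] := mollifier_exists n_gt0 u0.
have u1 : u <= d1 by rewrite /u ge_min lexx.
have u2 : u <= d2 by rewrite /u !ge_min lexx orbT.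
have u3 : u <= (r0 - r) / 2 by rewrite /u !ge_min lexx !orbT.
have D1 := @mollify_dist R n eta u a psi meta kp
  (fun x y xy => ltW (H1 x y (lt_le_trans xy u1))).
have D2 := @mollify_dist R n eta u a dpsi meta kd
  (fun x y xy => ltW (H2 x y (lt_le_trans xy u2))).
have ip := bmeas_intg (ckern_bmeas kp); have id := bmeas_intg (ckern_bmeas kd).
have ke := csmooth_ckern seta.
have tphi : wtest (cor eta psi).
  split; [exact: smooth_cor|exact: pcomm_cor|].
  exists (r + u); first lra.
  move=> x xr; rewrite /cor (@eq_Rintegral _ _ _ leb setT (fun=> 0)) => [|y _].
    by rewrite Rintegral_cst; [exact: mul0r|exact: measurableT].
  have [_ _ ev _] := meta.
  have [yr|yr] := leP u `|(y : V) - x|; first by rewrite ev// mul0r.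
  rewrite psi0 ?mulr0//; have := ler_distD (y : V) x x0; rewrite (distrC x y); lra.
have ce1 : ckern (cor eta psi) by exact: wtest_ckern.
have cedp : ckern (cor eta dpsi) by exact: cor_ckern.
(* The derivative falls on eta and is carried over to psi by parts. *)
have pE : partial i (cor eta psi) = cor eta dpsi.
  apply/funext => x; apply: partialE.
  have kde : ckern (partial i eta) by exact: (csmooth_ckern (csmooth_foldr [:: i] seta)).
  have de z : is_derive z (e_ i) (eta : V -> R^o) (partial i eta z) by exact: csmooth_is_derive.
  apply: is_derive_eq; first exact: (cor_is_derive _ ke kde de ip).
  by rewrite (cor_by_parts x ke kde kp kd de dpsiE) opprK.
have := whg _ tphi; rewrite pE => E.
have dist c1 c2 q : ckern c1 -> ckern c2 -> bmeas q -> (forall x, `|c1 x - c2 x| <= a) ->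
    `|\int[leb]_x (c1 x * q x) - \int[leb]_x (c2 x * q x)| <= a * L1norm q.
  move=> k1 k2 bq cc.
  have /bmeasP[m1 [M1 b1] _] := ckern_bmeas k1.
  have /bmeasP[m2 [M2 b2] _] := ckern_bmeas k2.
  exact: (Rintegral_dist_bound m1 m2 b1 b2 (bmeas_intg bq)).
have E1 := dist _ _ _ cedp kd bh D2.
have E2 := dist _ _ _ ce1 kp bg D1.
have aL : a * L <= e.
  by rewrite /a mulrAC ler_pdivrMr ?ltr_wpDl// ler_pM2l// lerDl.
move: E1 E2; rewrite E !ler_norml; move: aL; rewrite /L mulrDr.
by move=> aL /andP[A1 A2] /andP[A3 A4]; apply/andP; split; lra.
Qed.

Lemma compact_bounded_continuous (K : set V) f : compact K ->
  (forall x, K x -> {for x, continuous f}) -> exists2 M, 0 <= M & forall x, K x -> `|f x| <= M.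
Proof.
move=> cK cf; have [K0|/set0P/negP/negPn/eqP ->] := pselect (K !=set0); last by exists 0.
have [|c _ H] := @EVT_max_rV R n (fun x => `|f x|) K K0 cK.
  apply: continuous_in_subspaceT => x; rewrite inE => Kx.
  by apply: (@continuous_comp _ _ _ f (fun t => `|t|)); [exact: cf|exact: norm_continuous].
by exists `|f c| => // x Kx; apply: H; rewrite inE.
Qed.

Lemma bmeas_mul f h : (forall x, `|x - x0| <= r0 -> {for x, continuous f}) ->
  bmeas h -> (forall x, ~ ball x0 r0 x -> h x = 0) -> bmeas (fun x => f x * h x).
Proof.
move=> cf bh h0.
have /bmeasP[mh [M hM] [s hs]] := bh.
have [F F0 fF] := @compact_bounded_continuous _ f (@compact_cball _ _ x0 r0) cf.
apply/bmeasP; split.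
- rewrite (_ : (fun x => _) = (fun x => (f \_ (ball x0 r0)) x * h x)); last first.
    apply/funext => x; rewrite patchE; case: ifPn => //; rewrite notin_setE => /h0 ->.
    by rewrite !mulr0.
  apply: lmeasM mh; apply: borel_lmeas.
  apply/(measurable_restrictT _ _).1; first by apply: open_measurable_rV; exact: ball_open.
  apply: open_continuous_measurable_rV; first exact: ball_open.
  by move=> x; rewrite inE mx_norm_ball /ball_/= distrC => /ltW /cf.
- exists (F * M) => x; rewrite normrM.
  have [xB|/h0 ->] := pselect (ball x0 r0 x); last first.
    by rewrite normr0 mulr0 mulr_ge0//; apply: le_trans (hM 0).
  by rewrite ler_pM// fF//=; move: xB; rewrite mx_norm_ball /ball_/= distrC => /ltW.
- by exists s => x /hs ->; rewrite mulr0.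
Qed.

(** Product rule: the relation for h is tested against [f * phi], which may be no smoother than f;
    hence the recourse to [weak_partial_C1]. *)
Lemma wclassM D m f h : open D -> (forall x, `|x - x0| <= r0 -> D x) ->
  Ck D m f -> wclass m h -> wclass m (fun x => f x * h x).
Proof.
move=> oD sD; elim: m f h => [|m IHm] f h Cf Ch.
all: have supp : bmeas (fun x => f x * h x) /\ (forall x, ~ ball x0 r0 x -> f x * h x = 0)
  by split=> [|x xB]; [apply: bmeas_mul (wclass_bmeas Ch) (wclass_supp Ch) => x /sD;
      exact: (Ck_continuous Cf)|rewrite (wclass_supp Ch)// mulr0].
  by split.
split=> // i; have [_ /(_ i)[g Cg whg]] := Ch.
exists (fun x => f x * g x + partial i f x * h x).
  by apply: wclassD; apply: IHm => //; [exact: CkS|exact: Ck_partial|exact: wclassS].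
have bh := wclass_bmeas Ch; have bg := wclass_bmeas Cg.
have bfg : bmeas (fun x => f x * g x).
  by apply: bmeas_mul bg (wclass_supp Cg) => x /sD; exact: (Ck_continuous Cf).
have bdfh : bmeas (fun x => partial i f x * h x).
  apply: bmeas_mul bh (wclass_supp Ch) => x /sD.
  exact: (Ck_continuous (Ck_partial i Cf)).
move=> phi tp; have [sp _ [r rr0 pr]] := tp.
have cp := wtest_ckern tp; have cdp := wtest_partial_ckern i tp.
have Dp x : is_derive x (e_ i) (phi : V -> R^o) (partial i phi x).
  by apply: csmooth_is_derive; exact: wtest_csmooth.
pose E := [set x : V | r < `|x - x0|]; have oE : open E by exact: open_ball_compl.
(* f is controlled on D only, and phi vanishes on E. These open sets cover the space, and the
   regularity of [f * phi] is checked on each. *)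
have DE x : D x \/ E x.
  have [xr|xr] := leP `|x - x0| r0; first by left; exact: sD.
  by right; rewrite /E /=; lra.
have dp0 x : E x -> partial i phi x = 0 by move=> Ex; apply: (@partial_eq0 _ _ E).
have nearE x (c : V -> R) : E x -> (forall y, E y -> c y = 0) -> {for x, continuous c}.
  move=> Ex c0; have : Ck E 0 c.
    by apply: (@eq_Ck _ _ _ _ (fun=> 0)) => // [y /c0 ->//|]; exact: Ck_cst.
  by move=> [+ _]; apply.
have cphi : continuous phi by case: cp.
have cdphi : continuous (partial i phi) by case: cdp.
pose dpsi x := f x * partial i phi x + phi x * partial i f x.
have E1 := @weak_partial_C1 i h g (fun x => f x * phi x) dpsi r bh bg whg.
have {E1} : \int[leb]_x (dpsi x * h x) = - \int[leb]_x (f x * phi x * g x).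
  apply: E1 => //.
  - move=> x; have [Dx|Ex] := DE x; last by apply: nearE Ex _ => y /pr ->; rewrite mulr0.
    by apply: continuous_at_mul; [exact: Ck_continuous Cf _ Dx|exact: cphi].
  - move=> x; have [Dx|Ex] := DE x; last first.
      by apply: nearE Ex _ => y Ey; rewrite /dpsi dp0// pr// mulr0 mul0r addr0.
    apply: continuous_at_add.
      by apply: continuous_at_mul; [exact: Ck_continuous Cf _ Dx|exact: cdphi].
    by apply: continuous_at_mul; [exact: cphi|exact: Ck_continuous (Ck_partial i Cf) _ Dx].
  - move=> x; have [Dx|Ex] := DE x.
      by exact: is_derive_mul (Ck_partialP i Cf Dx) (Dp x).
    rewrite /dpsi dp0// pr// mulr0 mul0r addr0.
    apply: (@near_eq_is_derive R V R^o (fun=> 0)).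
    by apply: (near_of_open oE) => // y /pr ->; rewrite mulr0.
  - by move=> x /pr ->; rewrite mulr0.
have I1 : intg (fun x => partial i phi x * (f x * h x)).
  by apply: intg_ckernM => //; exact: supp.1.
have I2 : intg (fun x => phi x * (partial i f x * h x)) by exact: intg_ckernM.
have I3 : intg (fun x => phi x * (f x * g x)) by exact: intg_ckernM.
rewrite (@eq_Rintegral _ _ _ leb setT (fun x => partial i phi x * (f x * h x)
  + phi x * (partial i f x * h x))); last by move=> x _; rewrite /dpsi; ring.
rewrite RintegralD//.
rewrite (@eq_Rintegral _ _ _ leb setT (fun x => phi x * (f x * g x)) (fun x => f x * phi x * g x));
  last by move=> x _; ring.
move=> H; under [in RHS]eq_Rintegral do rewrite mulrDr.
by rewrite RintegralD//; lra.
Qed.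

End weak_class.

(** * Correlations of functions with weak derivatives *)

Section regularization.
Context {R : realType} {n : nat}.
Local Notation V := 'rV[R]_n.
Local Notation leb := (@lebesgue_rV R n).
Local Notation e_ i := (delta_mx ord0 i : V).
Hypothesis n_gt0 : (0 < n)%N.
Variables (x0 : V) (r0 : R).
Implicit Types (f g h k phi psi : V -> R).

(* k need not be differentiable: the identity holds for the mollifications of
   k, which are test functions, and passes to the uniform limit. *)
Lemma cor_weak_partial i h g k (rho : R) x : bmeas h -> bmeas g ->
  weak_partial x0 r0 i h g -> ckern k -> vanishes_outside k rho ->
  `|x - x0| + rho < r0 -> is_derive x (e_ i) (cor k h : V -> R^o) (cor k g x).
Proof.
move=> bh bg whg ck krho xr.
have ih := bmeas_intg bh; have ig := bmeas_intg bg; have ik := bmeas_intg (ckern_bmeas ck).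
pose gap := r0 - (`|x - x0| + rho).
have gap0 : 0 < gap by rewrite subr_gt0.
apply/is_derive_epsP => e e0.
have e20 : 0 < e / 2 by rewrite divr_gt0.
have [d d0 Hd] := cor_uniform ck ig e20.
pose E := `|(e_ i)| + 1; have E0 : 0 < E by rewrite ltr_wpDl.
exists (Num.min d (gap / 2) / E); first by rewrite divr_gt0// lt_min d0 divr_gt0.
move=> t; rewrite ltr_pdivlMr// lt_min => /andP[td tg].
have [->|tn0] := eqVneq t 0.
  by rewrite scale0r addr0 subrr mul0r subr0 normr0 mulr0.
have t0 : 0 < `|t| by rewrite normr_gt0.
set Lh := L1norm h; set Lg := L1norm g.
have Lh0 : 0 <= Lh by exact: L1norm_ge0.
have Lg0 : 0 <= Lg by exact: L1norm_ge0.
(* Mollifying k costs at most a times [2 * Lh + |t| * Lg], which has to stay below [e / 2 * |t|].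
   The scale of mollification may depend on t, since the radius allowed for t is already fixed. *)
pose C := 2 * Lh + `|t| * Lg + 1.
have C0 : 0 < C by rewrite ltr_wpDl// addr_ge0// mulr_ge0.
pose a := e / 2 * `|t| / C.
have a0 : 0 < a by rewrite divr_gt0// mulr_gt0.
have [d1 d10 H1] := uniformly_continuous_supp ck.1 krho a0.
(* As [|t| * E < gap / 2], a quarter of the gap keeps the translated kernel a test function at all
   [x + s e_i] with [|s| <= |t|]. *)
pose u := Num.min d1 (gap / 4).
have u0 : 0 < u by rewrite lt_min d10 divr_gt0.
have [eta [meta seta peta]] := mollifier_exists n_gt0 u0.
have u1 : u <= d1 by rewrite /u ge_min lexx.
have u2 : u <= gap / 4 by rewrite /u ge_min lexx orbT.
have D1 := @mollify_dist R n eta u a k meta ck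
  (fun x y xy => ltW (H1 x y (lt_le_trans xy u1))).
pose ke := cor eta k.
have ceta := csmooth_ckern seta.
have cke : ckern ke by exact: cor_ckern.
have vke : vanishes_outside ke (u + rho).
  by apply: vanishes_cor => //; case: meta.
have ske : smooth ke by exact: smooth_cor.
have cske : csmooth ke.
  by split=> //; exists (u + rho) => y /ltW; exact: vke.
have test y : `|y - x0| + (u + rho) < r0 -> wtest x0 r0 (fun z => ke (z - y)).
  move=> yr; split; [exact: smooth_shift|apply: pcomm_shift => //; exact: pcomm_cor|].
  exists (`|y - x0| + (u + rho)) => // z zr; apply: vke.
  by have := ler_distD y z x0; lra.
have drv y : `|y - x0| + (u + rho) < r0 ->
    is_derive y (e_ i) (cor ke h : V -> R^o) (cor ke g y).
  move=> yr.
  have cdke : ckern (partial i ke) by exact: (csmooth_ckern (csmooth_foldr [:: i] cske)).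
  have dke z : is_derive z (e_ i) (ke : V -> R^o) (partial i ke z) by exact: csmooth_is_derive.
  apply: is_derive_eq; first exact: (cor_is_derive _ cke cdke dke ih).
  have := whg _ (test y yr); have /= -> := foldr_partial_shift y [:: i] ske.
  by rewrite -/(cor _ _ _) => ->; rewrite opprK.
have nZ (s : R) : `|s *: (e_ i)| = `|s| * `|(e_ i)| by exact: normrZ.
have seg s : `|s| <= `|t| -> `|x + s *: (e_ i) - x0| + (u + rho) < r0.
  move=> st; have sE : `|s *: (e_ i)| <= `|t| * E.
    by rewrite nZ ler_pM// lerDl.
  have := ler_normD (x - x0) (s *: (e_ i)); rewrite addrAC /gap in u2 tg *; lra.
have [s st HF] := @MVT_line R V (cor ke h) (cor ke g) (e_ i) x t (fun s st => drv _ (seg s st)).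
have F1 y : `|cor ke h y - cor k h y| <= a * Lh by exact: cor_distl.
have F2 y : `|cor ke g y - cor k g y| <= a * Lg by exact: cor_distl.
have F3 : `|cor k g (x + s *: (e_ i)) - cor k g x| <= e / 2.
  apply: Hd; rewrite addrC addKr; apply: le_lt_trans td.
  by rewrite nZ ler_pM// lerDl.
rewrite (_ : _ - _ = (cor ke h x - cor k h x) -
  (cor ke h (x + t *: (e_ i)) - cor k h (x + t *: (e_ i))) +
  t * ((cor ke g (x + s *: (e_ i)) - cor k g (x + s *: (e_ i))) +
    (cor k g (x + s *: (e_ i)) - cor k g x))); last first.
  rewrite addrA subrK mulrBr -HF.
  move: (cor ke h x) (cor k h x) (cor ke h _) (cor k h _) (t * _) => A1 A2 A3 A4 A5.
  ring.
apply: le_trans (ler_normD _ _) _; rewrite normrM.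
have B1 := le_trans (ler_normB (cor ke h x - cor k h x)
  (cor ke h (x + t *: (e_ i)) - cor k h (x + t *: (e_ i)))) (lerD (F1 _) (F1 _)).
have B2 := le_trans (ler_normD _ _) (lerD (F2 (x + s *: (e_ i))) F3).
have B3 := ler_wpM2l (ltW t0) B2.
have aC : a * C = e / 2 * `|t| by rewrite /a divfK// gt_eqF.
have aC' : a * Lh + a * Lh + `|t| * (a * Lg) <= e / 2 * `|t|.
  rewrite -aC /C; have : a * (2 * Lh + `|t| * Lg + 1) =
    a * Lh + a * Lh + `|t| * (a * Lg) + a by ring.
  by move=> ->; rewrite lerDl ltW.
apply: le_trans (lerD B1 B3) _; rewrite mulrDr addrA.
apply: le_trans (lerD aC' (lexx _)) _.
by rewrite [`|t| * _]mulrC -mulrDl -splitr.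
Qed.

(** Each weak derivative of h yields one derivative of the correlation. When they are used up, what
    remains is merely bounded and [gain] adds one more, hence [m.+1]. *)
Lemma wclass_cor_Ck m h k (rho : R) :
  (forall (i : 'I_n) h, bmeas h -> exists2 G : V -> R, continuous G &
     forall x, is_derive x (e_ i) (cor k h : V -> R^o) (G x)) ->
  ckern k -> vanishes_outside k rho -> wclass x0 r0 m h ->
  Ck [set x | `|x - x0| + rho < r0] m.+1 (cor k h).
Proof.
move=> gain ck krho.
have oD : open [set x : V | `|x - x0| + rho < r0].
  rewrite (_ : mkset _ = ball x0 (r0 - rho)); first exact: ball_open.
  by apply/seteqP; split=> x; rewrite mx_norm_ball /ball_/= distrC ltrBrDr.
elim: m h => [|m IHm] h Ch.
  have /choice[G HG] : forall i, exists G : V -> R, continuous G /\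
      forall x, is_derive x (e_ i) (cor k h : V -> R^o) (G x).
    move=> i; have [G cG dG] := gain i h (wclass_bmeas Ch).
    by exists G.
  apply: (Ck_of_derive (g := G)) => //.
  - by move=> x _; apply: cor_continuous => //; exact/bmeas_intg/(wclass_bmeas Ch).
  - by move=> i x _; exact: (HG i).2.
  - by move=> i; split=> // x _; exact: (HG i).1.
have [[bh _] H] := Ch.
have /choice[G HG] : forall i, exists G : V -> R, wclass x0 r0 m G /\
    weak_partial x0 r0 i h G.
  by move=> i; have [g Cg wg] := H i; exists g.
apply: (Ck_of_derive (g := fun i => cor k (G i))) => //.
- by move=> x _; apply: cor_continuous => //; exact/bmeas_intg.
- move=> i x Dx; have [Cg wg] := HG i.
  exact: (cor_weak_partial bh (wclass_bmeas Cg) wg ck krho Dx).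
- by move=> i; apply: IHm; exact: (HG i).1.
Qed.

End regularization.

(** * From the Sobolev space to bounded representatives *)

Section almost_everywhere.
Context {R : realType} {n : nat}.
Local Notation V := 'rV[R]_n.
Local Notation leb := (@lebesgue_rV R n).
Implicit Types (f g h k phi psi : V -> R) (U : set V).

Lemma lebesgueT_gt0 : (0 < leb setT)%E.
Proof.
apply: lt_le_trans (lebesgue_ball_gt0 (0 : V) ltr01) _.
by apply: le_measure; rewrite ?inE//; exact: measurable_ball_rV.
Qed.

#[local] Instance lebesgue_ae_filter : ProperFilter (almost_everywhere leb).
Proof. by apply: ae_properfilter_algebraOfSetsType; exact: lebesgueT_gt0. Qed.

Lemma ae_eq_Rintegral f g : lmeas f -> lmeas g -> {ae leb, forall x, f x = g x} ->
  \int[leb]_x f x = \int[leb]_x g x.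
Proof.
move=> mf mg fg; congr fine.
apply: (@ae_eq_integral _ _ _ leb setT (EFin \o g) (EFin \o f)).
- exact: measurableT.
- exact/measurable_EFinP.
- exact/measurable_EFinP.
- by apply: filterS fg => x /= + _ => ->.
Qed.

(** Otherwise f would vanish almost everywhere and A would be a null set. *)
Lemma Rintegral_gt0_ae f (A : set (lebesgueType R n)) : intg f -> measurable A ->
  (0 < leb A)%E -> {ae leb, forall x, 0 <= f x} ->
  {ae leb, forall x, A x -> 0 < f x} -> 0 < \int[leb]_x f x.
Proof.
move=> fi mA A0 f0 fA.
have mf := intg_lmeas fi.
have E : \int[leb]_x f x = \int[leb]_x `|f x|.
  apply: ae_eq_Rintegral => //; first exact/intg_lmeas/intg_norm.
  by apply: filterS f0 => x /ger0_norm ->.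
rewrite E lt_neqAle L1norm_ge0 andbT eq_sym; apply/eqP => N0.
have ifin : (\int[leb]_x `|(f x)%:E| = 0)%E.
  have := intg_norm fi => /integrable_fin_num -/(_ measurableT).
  by move=> /fineK <-; congr EFin.
have mEf : @measurable_fun _ _ (lebesgueType R n) _ setT (EFin \o f).
  exact/measurable_EFinP.
have [+ _] := ae_eq_integral_abs leb measurableT mEf; move=> /(_ ifin) H.
have : {ae leb, forall x, ~ A x}.
  apply: filterS2 H fA => x /(_ I) /= [fx0] fA Ax.
  by have := fA Ax; rewrite (fx0 : f x = 0) ltxx.
move=> [B [mB B0 AB]].
have : (leb A <= leb B)%E.
  by apply: le_measure; rewrite ?inE// => x Ax; apply: AB => /= nA; exact: nA Ax.
by rewrite B0 leNgt A0.
Qed.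

Lemma Linfty_bound U f : Linfty U f ->
  lmeas (f \_ U) /\ exists M : R, {ae leb, forall x, `|(f \_ U) x| <= M}.
Proof.
move=> Lf; split; first by have /set_mem := sub_Lfun_mfun Lf.
have /set_mem /= := sub_Lfun_finLfun Lf.
rewrite /finite_norm unlock lebesgueT_gt0 => H.
exact: (@ess_supr_bounded _ _ _ leb (fun x => `|(f \_ U) x|)).
Qed.

Lemma Linfty_of_bound U f (M : R) : measurable (U : set (lebesgueType R n)) ->
  @measurable_fun _ _ (lebesgueType R n) R U f ->
  (forall x, U x -> `|f x| <= M) -> Linfty U f.
Proof.
move=> mU mf fM; rewrite /Linfty /=.
have mfU : lmeas (f \_ U) by apply/(measurable_restrictT _ _).1.
apply/andP; split; first by rewrite inE.
rewrite inE /= /finite_norm unlock lebesgueT_gt0.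
apply: (@le_lt_trans _ _ (Num.max M 0)%:E); last exact: ltry.
apply/ess_supP; apply: aeW => x; rewrite /= lee_fin patchE le_max.
by case: ifPn => [/set_mem /fM ->//|_]; rewrite normr0 lexx orbT.
Qed.

(** Truncation at an essential bound changes the function on a null set only and makes it bounded
    everywhere. *)
Lemma Linfty_clip U f (x0 : V) (r0 : R) : U `<=` ball x0 r0 -> Linfty U f ->
  exists g, [/\ bmeas g, forall x, ~ U x -> g x = 0 & {ae leb, forall x, (f \_ U) x = g x}].
Proof.
move=> Ub /Linfty_bound[mf [M0 fM0]].
pose M := `|M0|.
have M_ge0 : 0 <= M by exact: normr_ge0.
pose g x := Num.max (- M) (Num.min M ((f \_ U) x)).
have g0 x : ~ U x -> g x = 0.
  by move=> Ux; rewrite /g patchE memNset// min_r// max_r// oppr_le0.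
exists g; split=> //.
  apply/bmeasP; split.
  - by apply: lmeas_max (lmeas_cst _) _; apply: lmeas_min (lmeas_cst _) mf.
  - exists M => x; rewrite ler_norml le_max lexx/= ge_max ge_min lexx/= andbT.
    by rewrite (le_trans _ M_ge0)// oppr_le0.
  - exists (r0 + `|x0|) => x xr; apply: g0 => /Ub.
    rewrite mx_norm_ball /ball_/= distrC; have := lerB_dist x x0; lra.
apply: filterS fM0 => x /(le_trans) /(_ (ler_norm M0)).
by rewrite -/M ler_norml => /andP[h1 h2]; rewrite /g min_r// max_r.
Qed.

End almost_everywhere.

(** * From multi-indices to iterated weak derivatives *)

Section sobolev_to_weak_class.
Context {R : realType} {n : nat}.
Local Notation V := 'rV[R]_n.
Local Notation leb := (@lebesgue_rV R n).
Implicit Types (f g h k phi psi w : V -> R) (U : set V).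

Lemma mpartial_foldr (alpha : {ffun 'I_n -> nat}) phi : mpartial alpha phi =
  foldr (@partial R n) phi (flatten [seq nseq (alpha i) i | i <- enum 'I_n]).
Proof.
rewrite /mpartial; elim: (enum _) => //= i s ->.
rewrite foldr_cat; move: (foldr _ phi _) => f.
by elim: (alpha i) => //= k ->.
Qed.

Definition multiindex (s : seq 'I_n) : {ffun 'I_n -> nat} := [ffun i => count_mem i s].

Lemma mdeg_multiindex s : mdeg (multiindex s) = size s.
Proof.
rewrite /mdeg; under eq_bigr do rewrite ffunE.
elim: s => [|j s IHs] /=; first by rewrite big1.
rewrite big_split/= IHs (bigD1 j)//= eqxx big1 ?addn0// => i ij.
by rewrite eq_sym (negbTE ij).
Qed.

(** [mpartial] takes the coordinates in a fixed order, which is s only up to a permutation; [pcomm]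
    of the test functions makes up for it. *)
Lemma perm_multiindex s :
  perm_eq (flatten [seq nseq (multiindex s i) i | i <- enum 'I_n]) s.
Proof.
apply/allP => j _ /=; rewrite count_flatten -map_comp sumnE big_map.
rewrite big_enum/= (bigD1 j)//= count_nseq/= eqxx mul1n ffunE.
by rewrite big1 ?addn0// => i ij; rewrite count_nseq/= (negbTE ij).
Qed.

Lemma closure_compactly_contained (A K B : set V) : closed K -> compact K -> A `<=` K ->
  K `<=` B -> compactly_contained A B.
Proof.
move=> clK cK AK KB; have cAK : closure A `<=` K.
  by rewrite ((closure_id K).1 clK); exact: closure_subset.
split; last exact: subset_trans KB.
by apply: subclosed_compact cK cAK; exact: closed_closure.
Qed.

Lemma closed_cball (c : V) (r : R) : closed [set x : V | `|x - c| <= r].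
Proof. by apply: compact_closed; [exact: norm_hausdorff|exact: compact_cball]. Qed.

Lemma wtest_test_function (x0 : V) (r0 : R) phi : wtest x0 r0 phi ->
  test_function (ball x0 r0) phi.
Proof.
move=> [sp _ [r rr0 pr]]; split=> //.
apply: (closure_compactly_contained (@closed_cball x0 r) (@compact_cball R n x0 r)) => x /=.
  by move=> px; rewrite leNgt; apply: contra px => /pr ->.
by rewrite mx_norm_ball /ball_/= distrC; lra.
Qed.

Lemma wtest_foldr (x0 : V) (r0 : R) phi s : wtest x0 r0 phi ->
  wtest x0 r0 (foldr (@partial R n) phi s).
Proof.
move=> [sp pp [r rr0 pr]]; split; first exact: smooth_foldr.
  by move=> s1 s2 s12; rewrite -!foldr_cat; apply: pp; rewrite perm_cat2r.
exists r => // x xr.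
by apply: (@foldr_partial_eq0 _ _ [set x | r < `|x - x0|]) => //; exact: open_ball_compl.
Qed.

Lemma Rintegral_restrict_ae U f g psi : lmeas psi -> lmeas (f \_ U) -> lmeas g ->
  {ae leb, forall x, (f \_ U) x = g x} ->
  \int[leb]_(x in U) (f x * psi x) = \int[leb]_x (psi x * g x).
Proof.
move=> mp mf mg fg; rewrite Rintegral_mkcond.
rewrite (@eq_Rintegral _ _ _ leb setT (fun x => psi x * (f \_ U) x)); last first.
  by move=> x _; rewrite !patchE; case: ifPn => _; rewrite ?mulr0// mulrC.
apply: ae_eq_Rintegral.
- exact: lmeasM.
- exact: lmeasM.
- by apply: (@filterS _ _ (@lebesgue_ae_filter R n)) fg => x ->.
Qed.

(** The Sobolev condition relates every derivative to w directly, whereas [wclass] wants each to be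
    a weak derivative of the preceding one. Both relations give the same integral: the one for s
    tested against [partial i phi], and the one for [rcons s i] tested against phi. *)
Lemma sobolev_wclass (x0 : V) (r0 : R) l w : sobolev_infty l (ball x0 r0) w ->
  exists2 w', wclass x0 r0 l w' & {ae leb, forall x, (w \_ (ball x0 r0)) x = w' x}.
Proof.
move=> [Lw Dw]; set U := ball x0 r0.
have [w' [bw' w'0 ww']] := Linfty_clip (fun x => id) Lw.
exists w' => //; have mwU := (Linfty_bound Lw).1.
pose P s g := [/\ bmeas g, forall x, ~ U x -> g x = 0 &
  forall phi, wtest x0 r0 phi ->
    \int[leb]_x (foldr (@partial R n) phi s x * w' x) =
    (-1) ^+ size s * \int[leb]_x (phi x * g x)].
have exP s : (size s <= l)%N -> exists g, P s g.
  rewrite -mdeg_multiindex => /Dw[g Lg [_ _ H]].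
  have [g' [bg' g'0 gg']] := Linfty_clip (fun x => id) Lg.
  exists g'; split=> // phi tp; have := H _ (wtest_test_function tp).
  have mp psi : wtest x0 r0 psi -> lmeas psi.
    by move=> /wtest_ckern[cpsi _]; exact: continuous_lmeas.
  rewrite mdeg_multiindex.
  rewrite (Rintegral_restrict_ae (mp _ tp) (Linfty_bound Lg).1 bg'.1 gg') => <-.
  have [_ pp _] := tp.
  rewrite mpartial_foldr (pp _ _ (perm_multiindex s)).
  by rewrite (Rintegral_restrict_ae (mp _ (wtest_foldr s tp)) mwU bw'.1 ww').
have Pw m s g : (size s + m <= l)%N -> P s g -> wclass x0 r0 m g.
  elim: m s g => [|m IHm] s g sl [bg g0 Pg]; first by split.
  (* Appending i makes [partial i] the innermost derivative, the one applied to phi first. *)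
  split=> // i; have [|g2 Pg2] := exP (rcons s i).
    by rewrite size_rcons -addn1 (leq_trans _ sl)// leq_add2l.
  exists g2; first by apply: IHm Pg2; rewrite size_rcons addSnnS.
  move=> phi tp; have [_ _ /(_ phi tp)] := Pg2.
  rewrite foldr_rcons size_rcons (Pg _ (wtest_foldr [:: i] tp)) exprS mulN1r mulNr.
  rewrite -mulrN => /(congr1 (fun t => (-1) ^+ size s * t)).
  by rewrite !mulrA -expr2 sqrr_sign !mul1r.
by apply: (Pw l [::]) => //; split=> // phi tp; rewrite mul1r.
Qed.

End sobolev_to_weak_class.

(** * Mean values over balls and over cones *)

Section mean_value.
Context {R : realType} {n : nat}.
Local Notation V := 'rV[R]_n.
Local Notation leb := (@lebesgue_rV R n).
Implicit Types (f g h k u w : V -> R) (U : set V).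

(* Approximates max (0, J d - t) by steps of height d, that is, the cone of
   height J d by the indicators of the balls of radii d, 2 d, ..., J d. *)
Lemma cone_step_bound (t d : R) (J : nat) : 0 <= t -> 0 < d ->
  0 <= \sum_(j < J) d * (t < j.+1%:R * d)%R%:R - (Num.max t (J%:R * d) - t)
    <= d * (t < J%:R * d)%R%:R.
Proof.
move=> t0 d0; elim: J => [|J IHJ].
  by rewrite big_ord0 mul0r max_l// subrr subr0 lexx mulr_ge0// ltW.
rewrite big_ord_recr/=.
have E : J.+1%:R * d = J%:R * d + d by rewrite -natr1 mulrDl mul1r.
move: IHJ; rewrite E; move: (\sum_(_ < J) _) (J%:R * d) => S T.
rewrite !maxEle.
have [h1|h1] := leP t T; have [h2|h2] := leP t (T + d); rewrite ?mulr1 ?mulr0;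
  (have [h3|h3] := ltP t T); (have [h4|h4] := ltP t (T + d));
  rewrite ?mulr1 ?mulr0 => /andP[? ?]; apply/andP; split; lra.
Qed.

Lemma measurable_norm_ball N (x : V) (s : R) : is_norm N ->
  measurable ([set y : V | N (y - x) < s] : set (lebesgueType R n)).
Proof.
move=> nN; apply: borel_lebesgue_type; apply: open_measurable_rV.
rewrite (_ : mkset _ = (fun y : V => N (y - x)) @^-1` [set t | t < s])//.
apply: open_comp; last exact: open_lt.
by move=> y _; apply: continuous_sub_rV; exact: is_norm_continuous.
Qed.

(** The cone is within [r / J] of a Riemann sum over the radii, whose integral against h vanishes by
    hypothesis; J tends to infinity. This replaces Fubini's theorem in the average over the
    radii. *)
Lemma cor_cone_eq0 N h (x : V) (r : R) : is_norm N -> intg h -> 0 < r ->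
  (forall s, 0 < s -> s <= r ->
    \int[leb]_y (\1_[set y : V | N (y - x) < s] y * h y) = 0) ->
  cor (cone N r) h x = 0.
Proof.
move=> nN ih r0 H.
have L0 := L1norm_ge0 h.
have key J : (0 < J)%N -> `|cor (cone N r) h x| <= r / J%:R * L1norm h.
  move=> J0; pose d := r / J%:R.
  have Jd : J%:R * d = r by rewrite /d mulrC divfK// pnatr_eq0 -lt0n.
  have d0 : 0 < d by rewrite divr_gt0// ltr0n.
  pose A (j : nat) := [set y : V | N (y - x) < j.+1%:R * d].
  pose S (y : V) : R := \sum_(j < J) d * \1_(A j) y.
  have iA j : intg (fun y => \1_(A j) y * h y).
    apply: (intgM (M := 1)) => // [|y].
      by apply: measurable_indic; exact: measurable_norm_ball.
    by rewrite indicE; case: (_ \in _); rewrite ?normr1 ?normr0.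
  have mS : lmeas S.
    apply: measurable_sum => j.
    apply: lmeasM (lmeas_cst _) _.
    by apply: measurable_indic; exact: measurable_norm_ball.
  have Sb y : `|S y| <= \sum_(j < J) d.
    apply: le_trans (ler_norm_sum _ _ _) _; apply: ler_sum => j _.
    rewrite normrM gtr0_norm// indicE ler_piMr ?(ltW d0)//.
    by case: (_ \in _); rewrite ?normr1 ?normr0.
  have SI : \int[leb]_y (S y * h y) = 0.
    rewrite (@eq_Rintegral _ _ _ leb setT (fun y => \sum_(j < J) d * (\1_(A j) y * h y))); last first.
      by move=> y _; rewrite /S mulr_suml; apply: eq_bigr => j _; rewrite mulrA.
    have jJ (j : 'I_J) : j.+1%:R * d <= r by rewrite -Jd ler_pM2r// ler_nat.
    have HA (j : 'I_J) : \int[leb]_y (\1_(A j) y * h y) = 0.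
      by apply: H => //; rewrite mulr_gt0// ltr0n.
    elim: (index_enum _) => [|j s IHs].
      under eq_Rintegral do rewrite big_nil.
      by rewrite Rintegral_cst; [exact: mul0r|exact: measurableT].
    under eq_Rintegral do rewrite big_cons.
    rewrite RintegralD//; last 2 first.
    - exact: intgZ.
    - elim: s {IHs} => [|i s IHs].
        by under eq_fun do rewrite big_nil; rewrite (_ : (fun _ => _) = (fun y => 0 * h y));
          [exact: intgZ|apply/funext => y; rewrite mul0r].
      by under eq_fun do rewrite big_cons; apply: intgD => //; exact: intgZ.
    rewrite IHs addr0 (RintegralZl _ _ (iA j))//.
    by rewrite HA mulr0.
  have ck := cone_ckern nN r.
  have [cc [rr vr]] := ck; have [M _ kM] := bounded_supp cc vr.
  rewrite -[cor _ _ _]subr0 -SI.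
  apply: (Rintegral_dist_bound (M1 := M) _ mS _ Sb) => //.
  - by apply: continuous_lmeas; exact: continuous_sub_rV.
  move=> y; have := @cone_step_bound (N (y - x)) d J (is_norm_ge0 nN _) d0.
  rewrite Jd -/(cone N r (y - x)).
  rewrite (_ : \sum_(j < J) _ = S y); last first.
    by apply: eq_bigr => j _; rewrite indicE /A; congr (_ * (nat_of_bool _)%:R); apply/idP/idP; rewrite inE.
  rewrite distrC => /andP[h1 h2]; rewrite ger0_norm//; apply: le_trans h2 _.
  by rewrite ler_piMr ?(ltW d0)//; case: (_ < _).
apply/eqP; rewrite -normr_le0; apply/ler_addgt0Pr => e e0; rewrite add0r.
have C0 : 0 <= r * (L1norm h + 1) / e.
  by apply: divr_ge0 (ltW e0); apply: mulr_ge0 (ltW r0) _; rewrite addr_ge0.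
have [J HJ] : exists J : nat, r * (L1norm h + 1) / e < J%:R.
  by exists (Num.bound (r * (L1norm h + 1) / e)); exact: archi_boundP.
have J0 : 0 < J%:R :> R by exact: le_lt_trans C0 HJ.
apply: le_trans (key J _) _; first by rewrite -(ltr0n R).
rewrite mulrAC ler_pdivrMr// [e * _]mulrC.
rewrite ltr_pdivrMr// in HJ; apply: le_trans (ltW HJ).
by rewrite ler_pM2l// lerDl.
Qed.

End mean_value.

(** * The mean value identity with the cone as kernel *)

Section strongly_harmonic.
Context {R : realType} {n : nat}.
Local Notation V := 'rV[R]_n.
Local Notation leb := (@lebesgue_rV R n).
Variables (Omega : set V) (d : V -> V -> R) (N : V -> R) (w u : V -> R).
Hypotheses (oO : open Omega) (nN : is_norm N) (dN : forall x y, d x y = N (x - y)).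
Hypotheses (loc_w : L1loc Omega w)
  (w_gt0 : {ae leb, forall x, Omega x -> 0 < w x})
  (su : strongly_harmonic Omega d w u).
(** The sup-norm ball of radius rho contains the N-ball of radius r. When [|x - x0| + rho < r0], the
    N-balls about x of radius at most r are admissible in the mean value property. *)
Variables (x0 : V) (r0 r rho : R).
Hypotheses (sO : forall x, `|x - x0| <= r0 -> Omega x) (r_gt0 : 0 < r).
Hypothesis (Nrho : forall z, rho <= `|z| -> r <= N z).

Let U := ball x0 r0.
Let w1 := w \_ U.
Let uw1 := (fun x => u x * w x) \_ U.

Let Ucball : U `<=` [set x | `|x - x0| <= r0].
Proof. by move=> x; rewrite /U mx_norm_ball /ball_/= distrC => /ltW. Qed.

Let mU : measurable (U : set (lebesgueType R n)).
Proof. exact: measurable_ball_rV. Qed.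

Let intg_restrict f : leb.-integrable [set x | `|x - x0| <= r0] (EFin \o f) ->
  intg (f \_ U).
Proof.
move=> fi; have : leb.-integrable U (EFin \o f).
  apply: integrableS fi => //.
  by apply: borel_lebesgue_type; apply: closed_measurable_rV; exact: closed_cball.
by move=> /(integrable_mkcond _ mU); rewrite /intg -restrict_EFin.
Qed.

Let cball_Omega : [set x | `|x - x0| <= r0] `<=` Omega.
Proof. by move=> x; exact: sO. Qed.

Lemma intg_weight : intg w1.
Proof. by apply: intg_restrict; apply: loc_w.2 => //; exact: compact_cball. Qed.

Lemma intg_weighted : intg uw1.
Proof. by apply: intg_restrict; apply: su.1.2 => //; exact: compact_cball. Qed.

Lemma weight_ge0 : {ae leb, forall x, 0 <= w1 x}.
Proof.
apply: (@filterS _ _ (@lebesgue_ae_filter R n)) w_gt0 => x wx.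
rewrite /w1 patchE; case: ifPn => // /set_mem /Ucball /sO /wx; exact: ltW.
Qed.

Variable x : V.
Hypothesis xr : `|x - x0| + rho < r0.

Let B s := [set y : V | N (y - x) < s].

Let BU s : s <= r -> B s `<=` [set y | `|y - x| <= rho].
Proof.
move=> sr y /=; rewrite /B /= leNgt => Nyx; apply/negP => /ltW /Nrho.
by rewrite leNgt (lt_le_trans Nyx).
Qed.

Let cballU : [set y | `|y - x| <= rho] `<=` U.
Proof.
move=> y /= yx; rewrite /U mx_norm_ball /ball_/= distrC.
apply: le_lt_trans (ler_distD x y x0) _; apply: le_lt_trans xr.
by rewrite addrC lerD2l.
Qed.

Let mB s : measurable (B s : set (lebesgueType R n)).
Proof. exact: measurable_norm_ball. Qed.

Let mballE s : mball d x s = B s.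
Proof.
by apply/seteqP; split=> y; rewrite /mball /B /= dN -opprB is_normN.
Qed.

Let B_contained s : s <= r -> compactly_contained (mball d x s) Omega.
Proof.
move=> sr; rewrite mballE.
apply: (closure_compactly_contained (@closed_cball R n x rho) (@compact_cball R n x rho)).
  exact: BU.
by apply: subset_trans cballU (subset_trans Ucball cball_Omega).
Qed.

Let B_gt0 s : 0 < s -> (0 < leb (B s))%E.
Proof.
move=> s0.
have [C C0 NC] := is_norm_le nN.
apply: lt_le_trans (lebesgue_ball_gt0 x (divr_gt0 s0 C0)) _.
apply: le_measure; rewrite ?inE//; first exact: measurable_ball_rV.
move=> y; rewrite mx_norm_ball /ball_/= ltr_pdivlMr// mulrC distrC => yx.
exact: le_lt_trans (NC _) yx.
Qed.

Let int_B s f : s <= r -> \int[leb]_(y in B s) f y = \int[leb]_y (\1_(B s) y * (f \_ U) y).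
Proof.
move=> sr; rewrite Rintegral_mkcond; apply: eq_Rintegral => y _.
rewrite !patchE indicE; case: (boolP (y \in B s)) => [yB|_]; last by rewrite mul0r.
by rewrite mul1r ifT// inE; apply: cballU; apply: (BU sr); exact/set_mem.
Qed.

Let intg_B s f : intg f -> intg (fun y => \1_(B s) y * f y).
Proof.
move=> fi; apply: (intgM (M := 1)) => // [|y]; first by apply: measurable_indic.
by rewrite indicE; case: (_ \in _); rewrite ?normr1 ?normr0.
Qed.

Let w_pos_B s : s <= r -> {ae leb, forall y, B s y -> 0 < w1 y}.
Proof.
move=> sr; apply: (@filterS _ _ (@lebesgue_ae_filter R n)) w_gt0 => y wy By.
have Uy : U y by apply: cballU; exact: (BU sr).
by rewrite /w1 patchE mem_set//; apply: wy; apply/sO/Ucball.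
Qed.

Let int_w_gt0 s : 0 < s -> s <= r -> 0 < \int[leb]_(y in B s) w y.
Proof.
move=> s0 sr; rewrite int_B//; apply: (@Rintegral_gt0_ae _ _ _ (B s)).
- exact: intg_B intg_weight.
- exact: mB.
- exact: B_gt0.
- apply: (@filterS _ _ (@lebesgue_ae_filter R n)) weight_ge0 => y.
  by rewrite indicE; case: (_ \in _); rewrite ?mul1r ?mul0r.
- apply: (@filterS _ _ (@lebesgue_ae_filter R n)) (w_pos_B sr) => y + By.
  by rewrite indicE mem_set// mul1r; apply.
Qed.

Lemma cor_cone_weight_gt0 : 0 < cor (cone N r) w1 x.
Proof.
apply: (@Rintegral_gt0_ae _ _ _ (B r)).
- by apply: cor_intg intg_weight; exact: cone_ckern.
- exact: mB.
- exact: B_gt0.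
- apply: (@filterS _ _ (@lebesgue_ae_filter R n)) weight_ge0 => y w1y.
  by rewrite mulr_ge0// cone_ge0.
- apply: (@filterS _ _ (@lebesgue_ae_filter R n)) (w_pos_B (lexx r)) => y wy By.
  by rewrite mulr_gt0 ?wy// coneE ?subr_gt0// ltW.
Qed.

(** With x fixed, the mean value property says that [u x * w - u * w] has integral 0 over each
    N-ball about x of radius at most r, which is the hypothesis of [cor_cone_eq0]. *)
Lemma cone_mean_value : u x = (cor (cone N r) w1 x)^-1 * cor (cone N r) uw1 x.
Proof.
have ck := cone_ckern nN r; have iw := intg_weight; have iuw := intg_weighted.
have i1 := cor_intg x ck intg_weight; have i2 := cor_intg x ck intg_weighted.
pose h y := u x * w1 y - uw1 y.
have ih : intg h by apply: intgB => //; exact: intgZ.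
have : cor (cone N r) h x = 0.
  apply: cor_cone_eq0 => // s s0 sr; rewrite -/(B s).
  rewrite (@eq_Rintegral _ _ _ leb setT (fun y => u x * (\1_(B s) y * w1 y) - \1_(B s) y * uw1 y));
    last by move=> y _; rewrite /h; ring.
  have jw := intg_B s intg_weight; have juw := intg_B s intg_weighted.
  rewrite RintegralB//; last exact: intgZ.
  rewrite RintegralZl// -!int_B// -mballE.
  have wn0 : \int[leb]_(y in mball d x s) w y != 0 by rewrite mballE gt_eqF// int_w_gt0.
  rewrite {1}(su.2 x s s0 (B_contained sr)) mulrAC mulVf// mul1r.
  by rewrite subrr.
rewrite {1}/cor (@eq_Rintegral _ _ _ leb setT (fun y => u x * (cone N r ((y : V) - x) * w1 y)
    - cone N r ((y : V) - x) * uw1 y)); last by move=> y _; rewrite /h; ring.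
rewrite RintegralB//; last exact: intgZ.
rewrite RintegralZl// -/(cor _ w1 x) -/(cor _ uw1 x) => /eqP; rewrite subr_eq0 => /eqP <-.
by rewrite mulrC mulfK// gt_eqF// cor_cone_weight_gt0.
Qed.

End strongly_harmonic.

(** * Functions of class C^l are in W^(l,oo)_loc *)

Section classical_to_sobolev.
Context {R : realType} {n : nat}.
Local Notation V := 'rV[R]_n.
Local Notation leb := (@lebesgue_rV R n).
Local Notation e_ i := (delta_mx ord0 i : V).
Implicit Types (f g c phi psi : V -> R) (U K Omega : set V).

Lemma compact_norm_bounded K : compact K -> exists M : R, forall x, K x -> `|x| <= M.
Proof.
move=> /compact_bounded[M [_ KM]]; exists (M + 1) => x Kx.
by apply: KM => //; rewrite ltrDl.
Qed.

(** U and the complement of K are open and cover the space; the function is c on the one and 0 on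
    the other. *)
Lemma ckern_restrict U K c : open U -> compact K -> K `<=` U ->
  (forall x, U x -> {for x, continuous c}) -> (forall x, ~ K x -> c x = 0) ->
  ckern (c \_ U).
Proof.
move=> oU cK KU cc c0; split; last first.
  have [M KM] := compact_norm_bounded cK; exists (M + 1) => x xM.
  rewrite patchE; case: ifPn => // _; apply: c0 => /KM; lra.
have oK : open (~` K) by apply: closed_openC; apply: compact_closed => //; exact: norm_hausdorff.
move=> x; have [Ux|Ux] := pselect (U x).
  have : Ck U 0 (c \_ U).
    by apply: (@eq_Ck _ _ _ _ c) => // y Uy; rewrite patchE mem_set.
  by move=> [+ _]; apply.
have : Ck (~` K) 0 (c \_ U).
  apply: (@eq_Ck _ _ _ _ (fun=> 0)) => // [y Ky|]; last exact: Ck_cst.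
  by rewrite patchE; case: ifPn => // _; rewrite c0.
by move=> [+ _]; apply=> /KU.
Qed.

(** Extended by 0 off U, [f * psi] has a continuous i-th partial derivative of bounded support,
    whose integral vanishes. *)
Lemma Rintegral_by_parts U K f psi i : open U -> compact K -> K `<=` U ->
  Ck U 1 f -> smooth psi -> (forall x, ~ K x -> psi x = 0) ->
  \int[leb]_(x in U) (f x * partial i psi x) =
  - \int[leb]_(x in U) (partial i f x * psi x).
Proof.
move=> oU cK KU Cf sp p0.
have oK : open (~` K) by apply: closed_openC; apply: compact_closed => //; exact: norm_hausdorff.
have dp0 x : ~ K x -> partial i psi x = 0.
  by move=> Kx; apply: (@partial_eq0 _ _ (~` K)).
have cf x : U x -> {for x, continuous f} by exact: (Ck_continuous Cf).
have cdf x : U x -> {for x, continuous (partial i f)} by exact: (Ck_continuous (Ck_partial i Cf)).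
have cp : continuous psi by case: (sp [::]).
have cdp : continuous (partial i psi) by case: (sp [:: i]).
have kF : ckern ((fun x => f x * psi x) \_ U).
  apply: ckern_restrict cK KU _ _ => // x; last by move=> /p0 ->; rewrite mulr0.
  by move=> Ux; apply: continuous_at_mul; [exact: cf|exact: cp].
have k1 : ckern ((fun x => f x * partial i psi x) \_ U).
  apply: ckern_restrict cK KU _ _ => // x; last by move=> /dp0 ->; rewrite mulr0.
  by move=> Ux; apply: continuous_at_mul; [exact: cf|exact: cdp].
have k2 : ckern ((fun x => partial i f x * psi x) \_ U).
  apply: ckern_restrict cK KU _ _ => // x; last by move=> /p0 ->; rewrite mulr0.
  by move=> Ux; apply: continuous_at_mul; [exact: cdf|exact: cp].
rewrite Rintegral_mkcond [in RHS]Rintegral_mkcond.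
apply/eqP; rewrite -addr_eq0; apply/eqP.
rewrite -RintegralD//; last 2 first.
- exact: bmeas_intg (ckern_bmeas k1).
- exact: bmeas_intg (ckern_bmeas k2).
apply: (@Rintegral_derive_eq0 _ _ ((fun x => f x * psi x) \_ U) _ (e_ i)) => //.
  exact: ckernD.
move=> x; have [Ux|Ux] := pselect (U x).
  apply: (@near_eq_is_derive R V R^o (fun x => f x * psi x)).
    by apply: (near_of_open oU) => // y Uy; rewrite patchE mem_set.
  rewrite !patchE mem_set//.
  apply: is_derive_eq; first exact: is_derive_mul (Ck_partialP i Cf Ux) (partialP ((sp [::]).2 i x)).
  by rewrite [psi x * _]mulrC.
have Kx : ~ K x by move=> /KU.
apply: (@near_eq_is_derive R V R^o (fun=> 0)).
  by apply: (near_of_open oK) => // y /p0 py; rewrite patchE py mulr0 if_same.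
rewrite !patchE memNset// addr0; exact: (@is_derive_cst R V R^o).
Qed.

(* In the order opposite to that of foldr partial: each integration by parts
   moves the outermost partial derivative of the test function. *)
Definition foldl_partial f (s : seq 'I_n) := foldl (fun f i => partial i f) f s.

Lemma Ck_foldl Omega m f s : Ck Omega (size s + m) f -> Ck Omega m (foldl_partial f s).
Proof.
elim: s f => //= i s IHs f Cf; apply: IHs.
by apply: Ck_partial; rewrite -addSn.
Qed.

Lemma Rintegral_by_parts_iter U K f phi s : open U -> compact K -> K `<=` U ->
  Ck U (size s) f -> smooth phi -> (forall x, ~ K x -> phi x = 0) ->
  \int[leb]_(x in U) (f x * foldr (@partial R n) phi s x) =
  (-1) ^+ size s * \int[leb]_(x in U) (foldl_partial f s x * phi x).
Proof.
move=> oU cK KU + sp p0; elim: s f => [|i s IHs] f Cf /=; first by rewrite mul1r.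
have oK : open (~` K) by apply: closed_openC; apply: compact_closed => //; exact: norm_hausdorff.
rewrite (Rintegral_by_parts i oU cK KU _ (smooth_foldr s sp)).
- by rewrite IHs ?exprS ?mulN1r ?mulNr//; exact: Ck_partial.
- exact: Ck_le Cf.
- by move=> x Kx; apply: (@foldr_partial_eq0 _ _ (~` K)).
Qed.

Lemma continuous_measurable_on U c : open U -> (forall x, U x -> {for x, continuous c}) ->
  @measurable_fun _ _ (lebesgueType R n) R U c.
Proof.
move=> oU cc; apply: measurable_fun_lebesgue_type; first exact: open_measurable_rV.
by apply: open_continuous_measurable_rV => // x; rewrite inE => /cc.
Qed.

Lemma L1loc_continuous U c : open U -> (forall x, U x -> {for x, continuous c}) ->
  L1loc U c.
Proof.
move=> oU cc; have mc := continuous_measurable_on oU cc; split=> // K cK KU.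
have mK : measurable (K : set (lebesgueType R n)).
  apply: borel_lebesgue_type; apply: closed_measurable_rV.
  by apply: compact_closed => //; exact: norm_hausdorff.
apply: measurable_bounded_integrable => //.
- have [M KM] := compact_norm_bounded cK.
  apply: le_lt_trans (lebesgue_ball_lty (0 : V) (M + 1)).
  apply: le_measure; rewrite ?inE//; first exact: measurable_ball_rV.
  by move=> x /KM xM; rewrite mx_norm_ball /ball_/= sub0r normrN; lra.
- by apply: measurable_funS mc => //; apply: borel_lebesgue_type; exact: open_measurable_rV.
- have [|M M0 cM] := @compact_bounded_continuous _ _ K c cK; first by move=> x /KU /cc.
  exists M; split; first exact: num_real.
  by move=> L ML x Kx; exact: le_trans (cM x Kx) (ltW ML).
Qed.

Lemma Linfty_continuous Omega U c : open U -> compactly_contained U Omega ->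
  (forall x, Omega x -> {for x, continuous c}) -> Linfty U c.
Proof.
move=> oU [cU UO] cc.
have sU : U `<=` closure U by exact: subset_closure.
have [|M _ cM] := @compact_bounded_continuous _ _ (closure U) c cU; first by move=> x /UO /cc.
apply: (@Linfty_of_bound _ _ _ _ M).
- by apply: borel_lebesgue_type; exact: open_measurable_rV.
- by apply: continuous_measurable_on => // x /sU /UO /cc.
- by move=> x /sU /cM.
Qed.

Lemma mdeg_size (alpha : {ffun 'I_n -> nat}) :
  mdeg alpha = size (flatten [seq nseq (alpha i) i | i <- enum 'I_n]).
Proof.
rewrite size_flatten /shape -map_comp sumnE big_map big_enum /mdeg /=.
by apply: eq_bigr => i _; rewrite size_nseq.
Qed.

(** Classical derivatives are bounded on the compact closure of U, and integration by parts makes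
    them weak derivatives. *)
Lemma Ck_sobolev Omega l f : open Omega -> Ck Omega l f -> sobolev_infty_loc l Omega f.
Proof.
move=> oO Cf U oU UO; have [cU cUO] := UO.
have sUO : U `<=` Omega by apply: subset_trans cUO; exact: subset_closure.
split; first by apply: Linfty_continuous UO _ => //; exact: Ck_continuous Cf.
move=> alpha; rewrite mdeg_size; set s := flatten _ => sl.
have Cg : Ck Omega 0 (foldl_partial f s) by apply: Ck_foldl; rewrite addn0; exact: Ck_le Cf.
exists (foldl_partial f s).
  by apply: Linfty_continuous UO _ => //; exact: Ck_continuous Cg.
split.
- by apply: L1loc_continuous => // x /sUO; exact: Ck_continuous Cf x.
- by apply: L1loc_continuous => // x /sUO; exact: Ck_continuous Cg x.
move=> phi [sp [cK KU]]; rewrite mdeg_size -/s mpartial_foldr -/s.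
apply: Rintegral_by_parts_iter cK KU _ sp _ => //.
  exact: Ck_sub sUO (Ck_le sl Cf).
move=> x Kx; apply/eqP; apply: contrapT => /negP px; apply: Kx.
exact: subset_closure.
Qed.

End classical_to_sobolev.

(** * The bootstrap for strongly harmonic functions *)

Lemma cor_ae_eq {R : realType} {n : nat} (k g h : 'rV[R]_n -> R) : ckern k ->
  intg g -> intg h -> {ae @lebesgue_rV R n, forall x, g x = h x} -> cor k g = cor k h.
Proof.
move=> ck ig ih gh; apply/funext => x; apply: ae_eq_Rintegral.
- exact/intg_lmeas/cor_intg.
- exact/intg_lmeas/cor_intg.
- by apply: (@filterS _ _ (@lebesgue_ae_filter R n)) gh => y ->.
Qed.

Theorem theorem4 (R : realType) (n : nat) (n_gt0 : (0 < n)%N)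
    (Omega : set 'rV[R]_n) (d : 'rV[R]_n -> 'rV[R]_n -> R)
    (w : 'rV[R]_n -> R) (l : nat)
    (openOmega : open Omega)
    (norm_d : norm_induced d)
    (loc_w : L1loc Omega w)
    (w_gt0 : {ae (@lebesgue_rV R n), forall x, Omega x -> 0 < w x})
    (l_ge1 : (1 <= l)%N)
    (sob_w : sobolev_infty_loc l Omega w) :
  strongly_harmonic Omega d w `<=` sobolev_infty_loc l Omega.
Proof.
have [N nN dN] := norm_d.
move=> u su.
have [c c0 cN] := is_norm_ge nN.
suff Cu : forall m, (m <= l)%N -> Ck Omega m u by apply: Ck_sobolev => //; exact: Cu.
suff step : forall x0, Omega x0 -> exists D : set 'rV[R]_n, [/\ D x0, Ck D 0 u &
    forall m, (m < l)%N -> Ck Omega m u -> Ck D m.+1 u].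
  elim=> [|m IHm] ml; apply: Ck_local => x /step[D [Dx D0 DS]].
    by exists D.
  by exists D => //; apply: DS => //; apply: IHm; exact: ltnW.
move=> x0 Ox0; have /nbhs_ballP[e /= e0 eO] := open_nbhs_nbhs (conj openOmega Ox0).
pose r0 := e / 2; have r00 : 0 < r0 by rewrite divr_gt0.
have sO x : `|x - x0| <= r0 -> Omega x.
  move=> xr; apply: eO; rewrite mx_norm_ball /ball_/= distrC.
  by apply: le_lt_trans xr _; rewrite /r0; lra.
(* [rho < r0] puts x0 in D, and the factor c, from [c * |z| <= N z], makes the sup-norm ball of
   radius rho contain the N-ball of radius r. *)
pose rho := r0 / 2; pose r := c * rho.
have rho0 : 0 < rho by rewrite divr_gt0.
have r_gt0 : 0 < r by rewrite mulr_gt0.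
have Nrho (z : 'rV[R]_n) : rho <= `|z| -> r <= N z.
  by move=> zr; apply: le_trans (cN z); rewrite ler_pM2l.
pose k := cone N r; have ck : ckern k by exact: cone_ckern.
have vk : vanishes_outside k rho by move=> z /Nrho; exact: cone_eq0.
have gain (i : 'I_n) h : bmeas h -> exists2 G : 'rV[R]_n -> R, continuous G &
    forall x, is_derive x (delta_mx ord0 i : 'rV[R]_n) (cor k h : 'rV[R]_n -> R^o) (G x).
  exact: (cor_difference_of_convex (monotone_quotient_max_norm nN r _)
    (monotone_quotient_norm nN _) ck).
have UO : compactly_contained (ball x0 r0) Omega.
  apply: (closure_compactly_contained (@closed_cball R n x0 r0) (@compact_cball R n x0 r0)) => x; last exact: sO.
  by rewrite mx_norm_ball /ball_/= distrC => /ltW.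
have [w' Cw' ww'] := sobolev_wclass (sob_w _ (@ball_open _ _ x0 r0) UO).
set w1 := w \_ (ball x0 r0) in ww'.
pose uw1 := (fun x => u x * w x) \_ (ball x0 r0).
have iw1 : intg w1 by exact: (intg_weight loc_w sO).
have iuw1 : intg uw1 by exact: (intg_weighted su sO).
pose D := [set x : 'rV[R]_n | `|x - x0| + rho < r0].
have oD : open D.
  rewrite (_ : D = ball x0 (r0 - rho)); first exact: ball_open.
  by apply/seteqP; split=> x; rewrite /D mx_norm_ball /ball_/= distrC ltrBrDr.
have Dx0 : D x0 by rewrite /D /= subrr normr0 add0r /rho; lra.
have uE x : D x -> (cor k w1 x)^-1 * cor k uw1 x = u x.
  by move=> Dx; rewrite (cone_mean_value nN dN loc_w w_gt0 su sO r_gt0 Nrho Dx).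
have W0 x : D x -> cor k w1 x != 0.
  by move=> Dx; rewrite gt_eqF// (cor_cone_weight_gt0 nN loc_w w_gt0 sO r_gt0 Nrho Dx).
have Ck_quot m : Ck D m (cor k w1) -> Ck D m (cor k uw1) -> Ck D m u.
  by move=> Cw Cuw; apply: eq_Ck uE _ => //; apply: CkM => //; exact: CkV.
exists D; split=> //.
  (* At this stage [u w] is only known to be integrable, which suffices for continuity. *)
  by apply: (Ck_quot 0%N); (split; last by []) => x _; exact: cor_continuous.
move=> m ml Cu; have Cm := wclass_le (ltnW ml) Cw'.
have bw' := wclass_bmeas Cw'.
(* Being continuous on the closed ball, u is bounded there, so that [u w'] is bounded and has m
   bounded weak derivatives. *)
have Cuw' : wclass x0 r0 m (fun x => u x * w' x) by exact: wclassM sO Cu Cm.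
apply: (Ck_quot m.+1).
  rewrite (cor_ae_eq ck iw1 (bmeas_intg bw') ww').
  exact: wclass_cor_Ck.
(* [u w] and [u w'] differ on a null set of the ball, which correlations do not see. *)
rewrite (@cor_ae_eq _ _ k uw1 (fun x => u x * w' x) ck iuw1 (bmeas_intg (wclass_bmeas Cuw'))).
  exact: wclass_cor_Ck.
apply: (@filterS _ _ (@lebesgue_ae_filter R n)) ww' => x <-.
by rewrite /uw1 /w1 !patchE; case: ifPn => // _; rewrite mulr0.
Qed.
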